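(* Let $\Gamma$ be an arbitrary (possibly infinite) simplicial graph and let $G$ be the right angled Coxeter group associated with $\Gamma$. Then $G$ is hereditarily conjugacy separable and $2$-hereditarily conjugacy separable.
   Context: A simplicial graph $\Gamma$ is a pair $(V\Gamma,E\Gamma)$ where $E\Gamma$ is a set of 2-element subsets of $V\Gamma$. The right angled Coxeter group associated with $\Gamma$ is the graph product of cyclic groups of order 2, i.e. the group generated by $V\Gamma$ subject to the relations $v^2=1$ for all $v\in V\Gamma$ and $uv=vu$ for all $\{u,v\}\in E\Gamma$. For a class $\mathcal{C}$ of finite groups (closed under isomorphism), a group $G$ is $\mathcal{C}$-conjugacy separable if for all $f,g\in G$ that are not conjugate in $G$ there are $F\in\mathcal{C}$ and a homomorphism $\phi\colon G\to F$ such that $\phi(f)$ is not conjugate to $\phi(g)$ in $F$. A subgroup $H\le G$ is $\mathcal{C}$-open in $G$ if there is a normal subgroup $K\unlhd G$ with $K\le H$ and $G/K\in\mathcal{C}$. A group $G$ is $\mathcal{C}$-hereditarily conjugacy separable if $G$ and all its $\mathcal{C}$-open subgroups are $\mathcal{C}$-conjugacy separable. ''Hereditarily conjugacy separable'' is the case where $\mathcal{C}$ is the class of all finite groups, and ''$2$-hereditarily conjugacy separable'' the case where $\mathcal{C}$ is the class of all finite $2$-groups. *)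

(* Defs.v *)
From HB Require Import structures.
From mathcomp Require Import all_boot all_fingroup all_solvable.
From mathcomp Require Import generic_quotient boolp classical_sets.

Set Implicit Arguments.
Unset Strict Implicit.
Unset Printing Implicit Defensive.

Local Open Scope group_scope.
Local Open Scope quotient_scope.

(* Arbitrary (possibly infinite) groups are [groupType]s, their subgroups are
   [groupClosed] predicates, and finite groups are [finGroupType]s. *)

Definition subgroup_type (G : groupType) (H : groupClosed G) : Type :=
  {x : G | x \in H}.

Section SubgroupType.
Variables (G : groupType) (H : groupClosed G).

HB.instance Definition _ := SubChoice.on (subgroup_type H).

Fact subgroup_type_closed : group_closed H.
Proof. by split=> [|x y xH yH]; [exact: gpred1 | exact: gpredF]. Qed.

HB.instance Definition _ := SubChoice_isSubGroup.Build G (mem H)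
  (subgroup_type H) subgroup_type_closed.
End SubgroupType.

Record normal_subgroup (G : groupType) := NormalSubgroup {
  normal_subgroup_pred :> groupClosed G;
  normal_subgroupJ : forall x y : G,
    x \in normal_subgroup_pred -> x ^ y \in normal_subgroup_pred
}.

Section Quotient.
Variables (G : groupType) (K : normal_subgroup G).

Definition same_coset (x y : G) : bool := x^-1 * y \in (K : groupClosed G).

Lemma same_coset_refl : reflexive same_coset.
Proof. by move=> x; rewrite /same_coset mulVg gpred1. Qed.

Lemma same_coset_sym : symmetric same_coset.
Proof. by move=> x y; rewrite /same_coset -gpredV invgM invgK. Qed.

Lemma same_coset_trans : transitive same_coset.
Proof.
move=> y x z xy yz; rewrite /same_coset.
have -> : x^-1 * z = (x^-1 * y) * (y^-1 * z) by rewrite -mulgA mulVKg.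
exact: gpredM.
Qed.

Canonical same_coset_equiv :=
  EquivRel same_coset same_coset_refl same_coset_sym same_coset_trans.

Definition quotient_group : Type := {eq_quot same_coset}.

HB.instance Definition _ := Choice.on quotient_group.
HB.instance Definition _ := EqQuotient.on quotient_group.
Local Notation class := (\pi_quotient_group).

Lemma quotient_eqP (x y : G) :
  reflect (class x = class y) (same_coset x y).
Proof. by apply: (iffP idP) => [/eqmodP|/eqmodP]. Qed.

Definition quotient_one : quotient_group := class 1.
Definition quotient_mul (a b : quotient_group) : quotient_group :=
  class (repr a * repr b).
Definition quotient_inv (a : quotient_group) : quotient_group :=
  class (repr a)^-1.

Lemma pi_quotient_mul x y :
  quotient_mul (class x) (class y) = class (x * y).
Proof.
rewrite /quotient_mul; apply/quotient_eqP.
have /quotient_eqP xx : class (repr (class x)) = class x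
  by rewrite reprK.
have /quotient_eqP yy : class (repr (class y)) = class y
  by rewrite reprK.
move: (repr _) xx (repr _) yy => x' xx y' yy; rewrite /same_coset.
have -> : (x' * y')^-1 * (x * y) = (x'^-1 * x) ^ y' * (y'^-1 * y).
  by rewrite /conjg invgM !mulgA mulgK.
by apply: gpredM => //; apply: normal_subgroupJ.
Qed.

Lemma pi_quotient_inv x :
  quotient_inv (class x) = class x^-1.
Proof.
rewrite /quotient_inv; apply/quotient_eqP.
have /quotient_eqP xx : class (repr (class x)) = class x
  by rewrite reprK.
move: (repr _) xx => x' xx; rewrite /same_coset invgK -gpredV invgM invgK.
have -> : x * x'^-1 = (x'^-1 * x) ^ x'^-1.
  by rewrite /conjg invgK !mulgA mulgV mul1g.
exact: normal_subgroupJ.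
Qed.

Lemma quotient_mulA : associative quotient_mul.
Proof.
move=> a b c; rewrite -(reprK a) -(reprK b) -(reprK c).
move: (repr a) (repr b) (repr c) => x y z.
rewrite (pi_quotient_mul y z) (pi_quotient_mul x y).
by rewrite (pi_quotient_mul x (y * z)) (pi_quotient_mul (x * y) z) mulgA.
Qed.

Lemma quotient_mul1 : left_id quotient_one quotient_mul.
Proof. by move=> a; rewrite -(reprK a) pi_quotient_mul mul1g. Qed.

Lemma quotient_mulr1 : right_id quotient_one quotient_mul.
Proof. by move=> a; rewrite -(reprK a) pi_quotient_mul mulg1. Qed.

Lemma quotient_mulV : left_inverse quotient_one quotient_inv quotient_mul.
Proof.
by move=> a; rewrite -(reprK a) pi_quotient_inv pi_quotient_mul mulVg.
Qed.

Lemma quotient_mulrV : right_inverse quotient_one quotient_inv quotient_mul.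
Proof.
by move=> a; rewrite -(reprK a) pi_quotient_inv pi_quotient_mul mulgV.
Qed.

HB.instance Definition _ := isGroup.Build quotient_group
  quotient_mulA quotient_mul1 quotient_mulr1 quotient_mulV quotient_mulrV.
End Quotient.

Section ConjugacySeparability.
Implicit Types (C : finGroupType -> Prop) (G : groupType).

Definition conjugate G (f g : G) : Prop := exists x : G, g = f ^ x.

(* Between groups, a [{multiplicative _ -> _}] map is a group homomorphism:
   it automatically preserves 1 and inverses. *)
Definition isomorphic (G H : groupType) : Prop :=
  exists phi : {multiplicative G -> H}, bijective phi.

(* A class of finite groups is a predicate on [finGroupType]; a [groupType]
   belongs to it when it is isomorphic to one of its members. *)
Definition in_class C G : Prop :=
  exists F : finGroupType, C F /\ isomorphic G F.

Definition conjugacy_separable C G : Prop :=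
  forall f g : G, ~ conjugate f g ->
  exists F : finGroupType, C F /\
  exists phi : {multiplicative G -> F}, ~ conjugate (phi f) (phi g).

Definition class_open C G (H : groupClosed G) : Prop :=
  exists K : normal_subgroup G,
    {subset K <= H} /\ in_class C (quotient_group K).

Definition hereditarily_conjugacy_separable C G : Prop :=
  conjugacy_separable C G /\
  forall H : groupClosed G,
    class_open C H -> conjugacy_separable C (subgroup_type H).

Definition finite_groups : finGroupType -> Prop := fun=> True.

Definition finite_pgroups (p : nat) : finGroupType -> Prop :=
  fun F => p.-group [set: F].
End ConjugacySeparability.

(* The letter [(x, false)] stands for the generator [x] and [(x, true)] for its
   formal inverse. *)
Definition word (X : Type) : Type := seq (X * bool).

HB.instance Definition _ (X : Type) := gen_eqMixin (word X).
HB.instance Definition _ (X : Type) := gen_choiceMixin (word X).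

Definition word_inv (X : Type) (w : word X) : word X :=
  rev [seq (l.1, ~~ l.2) | l <- w].

(* The group presented by generators [X] and relations [u = v] for [R u v], as
   the words modulo the smallest congruence containing free cancellation and
   [R]. *)
Section PresentedGroup.
Variables (X : Type) (R : word X -> word X -> Prop).

Inductive word_equiv : word X -> word X -> Prop :=
| word_equiv_refl u : word_equiv u u
| word_equiv_sym u v : word_equiv u v -> word_equiv v u
| word_equiv_trans u v w : word_equiv u v -> word_equiv v w -> word_equiv u w
| word_equiv_cat u u' v v' :
    word_equiv u u' -> word_equiv v v' -> word_equiv (u ++ v) (u' ++ v')
| word_equiv_cancel x b : word_equiv [:: (x, b); (x, ~~ b)] [::]
| word_equiv_rel u v : R u v -> word_equiv u v.

Definition word_equivb (u v : word X) : bool := `[< word_equiv u v >].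

Lemma word_equivb_refl : reflexive word_equivb.
Proof. by move=> u; apply/asboolP/word_equiv_refl. Qed.

Lemma word_equivb_sym : symmetric word_equivb.
Proof.
by move=> u v; apply/asboolP/asboolP; apply: word_equiv_sym.
Qed.

Lemma word_equivb_trans : transitive word_equivb.
Proof.
move=> v u w /asboolP uv /asboolP vw; apply/asboolP.
exact: word_equiv_trans uv vw.
Qed.

Canonical word_equivb_equiv :=
  EquivRel word_equivb word_equivb_refl word_equivb_sym word_equivb_trans.

Definition presented_group : Type := {eq_quot word_equivb}.

HB.instance Definition _ := Choice.on presented_group.
HB.instance Definition _ := EqQuotient.on presented_group.
Local Notation class := (\pi_presented_group).

Lemma presented_eqP (u v : word X) :
  class u = class v <-> word_equiv u v.
Proof.
split=> [/eqmodP/asboolP //|uv]; apply/eqmodP; exact/asboolP.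
Qed.

Lemma word_equiv_repr u : word_equiv (repr (class u)) u.
Proof. by apply/presented_eqP; rewrite reprK. Qed.

Lemma word_equiv_catV u : word_equiv (u ++ word_inv u) [::].
Proof.
elim: u => [|[x b] u IH]; first exact: word_equiv_refl.
rewrite /word_inv /= rev_cons -rcons_cat -cat1s -cats1.
apply: word_equiv_trans (word_equiv_cancel x b).
apply: (@word_equiv_cat [:: _] [:: _] _ [:: _]); first exact: word_equiv_refl.
exact: (@word_equiv_cat _ [::]) IH (word_equiv_refl _).
Qed.

Lemma word_invK (u : word X) : word_inv (word_inv u) = u.
Proof.
rewrite /word_inv map_rev revK -map_comp -[RHS]map_id.
by apply: eq_map => -[x b] /=; rewrite negbK.
Qed.

Lemma word_equiv_catVl u : word_equiv (word_inv u ++ u) [::].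
Proof. by rewrite -{2}(word_invK u); apply: word_equiv_catV. Qed.

Lemma word_equiv_inv u v :
  word_equiv u v -> word_equiv (word_inv u) (word_inv v).
Proof.
move=> uv.
have e1 : word_equiv (word_inv u) (word_inv u ++ v ++ word_inv v).
  rewrite -{1}[word_inv u]cats0.
  apply: word_equiv_cat (word_equiv_refl _) _.
  exact/word_equiv_sym/word_equiv_catV.
apply: word_equiv_trans e1 _; rewrite catA.
apply: (@word_equiv_cat _ [::]) (word_equiv_refl _).
apply: word_equiv_trans (word_equiv_catVl u).
exact: word_equiv_cat (word_equiv_refl _) (word_equiv_sym uv).
Qed.

Definition presented_one : presented_group := class ([::] : word X).
Definition presented_mul (a b : presented_group) : presented_group :=
  class (repr a ++ repr b : word X).
Definition presented_inv (a : presented_group) : presented_group :=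
  class (word_inv (repr a)).

Lemma pi_presented_mul (u v : word X) :
  presented_mul (class u) (class v) = class (u ++ v : word X).
Proof. by apply/presented_eqP/word_equiv_cat; apply: word_equiv_repr. Qed.

Lemma pi_presented_inv (u : word X) :
  presented_inv (class u) = class (word_inv u).
Proof. exact/presented_eqP/word_equiv_inv/word_equiv_repr. Qed.

Lemma presented_mulA : associative presented_mul.
Proof.
move=> a b c; rewrite -(reprK a) -(reprK b) -(reprK c).
move: (repr a) (repr b) (repr c) => x y z.
rewrite (pi_presented_mul y z) (pi_presented_mul x y).
by rewrite (pi_presented_mul x (y ++ z)) (pi_presented_mul (x ++ y) z) catA.
Qed.

Lemma presented_mul1 : left_id presented_one presented_mul.
Proof. by move=> a; rewrite -(reprK a) pi_presented_mul. Qed.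

Lemma presented_mulr1 : right_id presented_one presented_mul.
Proof. by move=> a; rewrite -(reprK a) pi_presented_mul cats0. Qed.

Lemma presented_mulV : left_inverse presented_one presented_inv presented_mul.
Proof.
move=> a; rewrite -(reprK a) pi_presented_inv pi_presented_mul.
exact/presented_eqP/word_equiv_catVl.
Qed.

Lemma presented_mulrV : right_inverse presented_one presented_inv presented_mul.
Proof.
move=> a; rewrite -(reprK a) pi_presented_inv pi_presented_mul.
exact/presented_eqP/word_equiv_catV.
Qed.

HB.instance Definition _ := isGroup.Build presented_group
  presented_mulA presented_mul1 presented_mulr1 presented_mulV presented_mulrV.

Definition presented_gen (x : X) : presented_group :=
  class ([:: (x, false)] : word X).

Definition eval_word (H : groupType) (f : X -> H) (w : word X) : H :=
  \prod_(l <- w) (if l.2 then (f l.1)^-1 else f l.1).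

Lemma eval_word_cat (H : groupType) (f : X -> H) (u v : word X) :
  eval_word f (u ++ v) = eval_word f u * eval_word f v.
Proof. by rewrite /eval_word big_cat. Qed.

Lemma eval_presented_gen (w : word X) : eval_word presented_gen w = class w.
Proof.
elim: w => [|[x b] w IH]; first by rewrite /eval_word big_nil.
rewrite /eval_word big_cons -/(eval_word presented_gen w) {}IH /=.
have -> : (if b then (presented_gen x)^-1 else presented_gen x) =
          class ([:: (x, b)] : word X).
  by case: b => //; rewrite /presented_gen [_^-1]pi_presented_inv.
exact: pi_presented_mul.
Qed.

Lemma presented_relP (u v : word X) :
  R u v -> eval_word presented_gen u = eval_word presented_gen v.
Proof.
by rewrite !eval_presented_gen => uv; apply/presented_eqP/word_equiv_rel.
Qed.

Lemma presented_universal (H : groupType) (f : X -> H) :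
  (forall u v, R u v -> eval_word f u = eval_word f v) ->
  exists! phi : presented_group -> H,
    {morph phi : a b / a * b} /\ forall x, phi (presented_gen x) = f x.
Proof.
move=> fR.
have fE u v : word_equiv u v -> eval_word f u = eval_word f v.
  elim=> {u v} [//|u v _ ->//|u v w _ -> _ ->//|u u' v v' _ eu _ ev|x b|//].
    by rewrite !eval_word_cat eu ev.
  rewrite /eval_word !big_cons big_nil /= mulg1.
  by case: b; rewrite /= ?mulgV ?mulVg.
have fpi u : eval_word f (repr (class u)) = eval_word f u.
  exact/fE/word_equiv_repr.
exists (fun a => eval_word f (repr a)); split.
  split=> [a b|x]; last by rewrite fpi /eval_word big_seq1.
  by rewrite -eval_word_cat -[LHS]/(eval_word f (repr (class _))) fpi.
move=> psi [psiM psi_gen]; apply: funext => a.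
rewrite -{2}(reprK a) -eval_presented_gen.
have psi1 : psi 1 = 1.
  by apply: (mulgI (psi 1)); rewrite -psiM !mulg1.
have psiV b : psi b^-1 = (psi b)^-1.
  by apply: (mulgI (psi b)); rewrite -psiM !mulgV.
elim: (repr a : word X) => [|[x b] w IH]; first by rewrite /eval_word !big_nil.
rewrite /eval_word !big_cons psiM -/(eval_word f w) IH; congr (_ * _).
by case: b => /=; rewrite ?psiV psi_gen.
Qed.
End PresentedGroup.

Record simplicial_graph := SimplicialGraph {
  vertex :> Type;
  edges : set (set vertex);
  edges_card2 : forall e, edges e ->
    exists u v : vertex, u <> v /\ e = [set u; v]%classic
}.

Inductive racg_rel (Gamma : simplicial_graph) :
    word Gamma -> word Gamma -> Prop :=
| racg_rel_square (v : Gamma) :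
    racg_rel [:: (v, false); (v, false)] [::]
| racg_rel_commute (u v : Gamma) : edges [set u; v]%classic ->
    racg_rel [:: (u, false); (v, false)] [:: (v, false); (u, false)].

Definition right_angled_coxeter_group (Gamma : simplicial_graph) : groupType :=
  presented_group (@racg_rel Gamma).

(* Main.v *)
(* Write G_U for the subgroup generated by a set U of vertices; it is a retract.
   Both classes are treated at once: it suffices to show that for f, g in G and a
   finite quotient a of G there is a finer finite quotient b, an extension by
   2-groups, such that every x with f x = x g modulo b agrees modulo a with some y
   with f y = y g in G. Restricted to a subgroup containing the kernel of a, such a
   b separates non-conjugate elements.
   The quotients b come from a Magnus embedding. Given a vertex s, whose star
   generates a subgroup with image H in a quotient P, send s to (1 + X) s in an
   algebra over F_2 generated by P and a letter X with X^2 = 0 centralized by H,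
   truncated at large degree. The top-degree monomial of a word reduced in s
   records its s-syllables modulo H.
   First, comparing monomials reduces an equation f e = e g with e in G_D, where f
   and g are killed by the retraction onto G_D, to membership of e in translates
   u G_{lk s} w inside a smaller group; hence an intersection of such translates is
   empty or a translate u G_K w, and can be detected in finite quotients. Secondly,
   for f cyclically reduced in s, the trace (sums of top-degree coefficients over
   rotation classes) shows that an x conjugating f to g modulo b is, up to powers
   of f and an initial segment of f, an element of the star of s that conjugates a
   rotation of f to g. One concludes by induction: a conjugation equation with
   unknown in G_D becomes one with unknown in G_K, where K is contained in D and in
   the link of a vertex whose link does not contain D. *)

From HB Require Import structures.
From mathcomp Require Import all_boot all_fingroup all_solvable.
From mathcomp Require Import generic_quotient boolp classical_sets.
Require Import Defs.

Set Implicit Arguments.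
Unset Strict Implicit.
Unset Printing Implicit Defensive.

Local Open Scope group_scope.

(** * Generators and retractions *)

Section Homomorphisms.
Variables (G H : groupType) (f : {multiplicative G -> H}).

Lemma homM x y : f (x * y) = f x * f y.
Proof. exact: gmulfM. Qed.

Lemma hom1 : f 1 = 1.
Proof. by apply: (mulgI (f 1)); rewrite -gmulfM !mulg1. Qed.

Lemma homV x : f x^-1 = (f x)^-1.
Proof. by apply/esym/mulg1_eq; rewrite -gmulfM mulgV hom1. Qed.
End Homomorphisms.

Section Generators.
Variable Gamma : simplicial_graph.
Local Notation V := {classic (vertex Gamma)}.
Local Notation G := (right_angled_coxeter_group Gamma).

Definition adj (u v : V) : bool :=
  `[< edges [set (u : vertex Gamma); v]%classic >].

Lemma adj_sym u v : adj u v = adj v u.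
Proof. by rewrite /adj setUC. Qed.

Lemma adj_irr v : adj v v = false.
Proof.
apply/asboolP => /edges_card2 [a [b [neq_ab E]]]; apply: neq_ab.
have : [set a; b]%classic a by left.
have : [set a; b]%classic b by right.
by rewrite -E => -[] -> [] ->.
Qed.

Definition gen (v : V) : G := presented_gen (@racg_rel Gamma) v.

Lemma gen_sq v : gen v * gen v = 1.
Proof.
have := presented_relP (racg_rel_square v).
by rewrite /eval_word !big_cons !big_nil /= !mulg1.
Qed.

Lemma genV v : (gen v)^-1 = gen v.
Proof. by apply/mulg1_eq; rewrite gen_sq. Qed.

Lemma genK v : cancel (mul (gen v)) (mul (gen v)).
Proof. by move=> x; rewrite mulgA gen_sq mul1g. Qed.

Lemma gen_comm u v : adj u v -> gen u * gen v = gen v * gen u.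
Proof.
move=> /asboolP /racg_rel_commute /presented_relP.
by rewrite /eval_word !big_cons !big_nil /= !mulg1.
Qed.

Lemma racg_ind (P : G -> Prop) :
  P 1 -> (forall v x, P x -> P (gen v * x)) -> forall x, P x.
Proof.
move=> P1 PM x; have -> : x = eval_word gen (repr x : word Gamma).
  by rewrite /gen eval_presented_gen reprK.
elim: (repr x : word Gamma) => [|[v b] w IH]; first by rewrite /eval_word big_nil.
by rewrite /eval_word big_cons /= genV; case: b; apply: PM.
Qed.

Section Lift.
Variables (H : groupType) (f : V -> H).
Hypothesis f_sq : forall v, f v * f v = 1.
Hypothesis f_comm : forall u v, adj u v -> f u * f v = f v * f u.

Lemma racg_liftP : {phi : {multiplicative G -> H} | forall v, phi (gen v) = f v}.
Proof.
have fR u v : racg_rel u v ->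
    eval_word (f : vertex Gamma -> H) u = eval_word (f : vertex Gamma -> H) v.
  case=> {u v} [v|u v uv]; rewrite /eval_word !big_cons !big_nil /= ?mulg1 //.
  by apply/f_comm/asboolP.
have [phi [[phiM phi_gen] _]] := cid (presented_universal fR).
pose phiX := HB.pack_for {multiplicative G -> H} phi
  (isMultiplicative.Build _ _ phi phiM).
by exists phiX => v; apply: phi_gen.
Qed.

Definition racg_lift : {multiplicative G -> H} := sval racg_liftP.

Lemma racg_lift_gen v : racg_lift (gen v) = f v.
Proof. exact: (svalP racg_liftP). Qed.
End Lift.

Section Retraction.
Variable U : pred V.

Fact retr_gen_sq v : (if U v then gen v else 1) * (if U v then gen v else 1) = 1.
Proof. by case: (U v); rewrite ?gen_sq ?mul1g. Qed.

Fact retr_gen_comm u v : adj u v ->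
  (if U u then gen u else 1) * (if U v then gen v else 1)
  = (if U v then gen v else 1) * (if U u then gen u else 1).
Proof.
by move=> /gen_comm uv; case: (U u); case: (U v); rewrite ?mul1g ?mulg1.
Qed.

Definition retr : {multiplicative G -> G} := racg_lift retr_gen_sq retr_gen_comm.

Lemma retr_gen v : retr (gen v) = if U v then gen v else 1.
Proof. exact: racg_lift_gen. Qed.

(** The subgroup generated by [U], encoded as the fixed points of the retraction, so that
    intersections and restrictions reduce to composing retractions. *)
Definition parab (x : G) : Prop := retr x = x.

Lemma parab1 : parab 1. Proof. by rewrite /parab hom1. Qed.

Lemma parabM x y : parab x -> parab y -> parab (x * y).
Proof. by rewrite /parab gmulfM => -> ->. Qed.

Lemma parabV x : parab x -> parab x^-1.
Proof. by rewrite /parab homV => ->. Qed.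

Lemma parab_gen v : U v -> parab (gen v).
Proof. by rewrite /parab retr_gen => ->. Qed.
End Retraction.

Lemma retrI U W x : retr U (retr W x) = retr (fun v => U v && W v) x.
Proof.
elim/racg_ind: x => [|v x IH]; first by rewrite !hom1.
rewrite !gmulfM /= IH !retr_gen; case: (W v); rewrite ?andbT ?andbF ?hom1 //.
by rewrite retr_gen.
Qed.

Lemma retrC U W x : retr U (retr W x) = retr W (retr U x).
Proof.
by rewrite !retrI; congr (retr _ x); apply: funext => v; rewrite andbC.
Qed.

Lemma retr_parab U x : parab U (retr U x).
Proof.
rewrite /parab retrI; congr (retr _ x); apply: funext => v; exact: andbb.
Qed.

Lemma parab_retr U W x : parab U x -> parab U (retr W x).
Proof. by rewrite /parab retrC => ->. Qed.

Lemma parab_sub (U W : pred V) x :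
  (forall v, U v -> W v) -> parab U x -> parab W x.
Proof.
move=> UW; rewrite /parab => <-; rewrite retrI; congr (retr _ x).
by apply: funext => v; case Uv: (U v); rewrite ?andbF // UW.
Qed.

Lemma parabI U W x : parab U x -> parab W x -> parab (fun v => U v && W v) x.
Proof. by rewrite /parab -retrI => Ux ->. Qed.

Lemma parab_ind (U : pred V) (P : G -> Prop) :
  P 1 -> (forall v x, U v -> parab U x -> P x -> P (gen v * x)) ->
  forall x, parab U x -> P x.
Proof.
move=> P1 PM x <-; elim/racg_ind: x => [|v x IH]; first by rewrite hom1.
rewrite gmulfM /= retr_gen; case Uv: (U v); last by rewrite mul1g.
exact/PM/IH/retr_parab.
Qed.

Lemma retr0 x : retr (fun=> false) x = 1.
Proof.
elim/racg_ind: x => [|v x IH]; first by rewrite hom1.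
by rewrite gmulfM /= IH retr_gen mul1g.
Qed.

Lemma parab0 x : parab (fun=> false) x -> x = 1.
Proof. by rewrite /parab retr0. Qed.

Lemma retrT x : retr predT x = x.
Proof.
elim/racg_ind: x => [|v x IH]; first by rewrite hom1.
by rewrite gmulfM /= IH retr_gen.
Qed.

Lemma finite_support x : exists F : seq V, parab (fun v => v \in F) x.
Proof.
elim/racg_ind: x => [|v x [F Fx]]; first by exists [::]; apply: parab1.
exists (v :: F); apply: parabM; first by apply: parab_gen; apply: mem_head.
by apply: parab_sub Fx => u uF; rewrite inE uF orbT.
Qed.

Lemma parab_comm (U : pred V) s x : (forall v, U v -> adj s v || (v == s)) ->
  parab U x -> gen s * x = x * gen s.
Proof.
move=> Us; elim/parab_ind => [|v y /Us sv _ IH]; first by rewrite mul1g mulg1.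
rewrite -mulgA -IH !mulgA; congr (_ * _); case/orP: sv => [/gen_comm//|/eqP->//].
Qed.
End Generators.

(** * Finite quotients *)

Section HomImage.
Variables (H : groupType) (F : finGroupType) (psi : {multiplicative H -> F}).

Definition hom_image : {set F} := [set y : F | `[< exists x, psi x = y >]].

Lemma mem_hom_image x : psi x \in hom_image.
Proof. by rewrite finset.in_set; apply/asboolP; exists x. Qed.

Fact hom_image_group_set : group_set hom_image.
Proof.
apply/group_setP; split; first by rewrite -(hom1 psi) mem_hom_image.
move=> y z; rewrite !finset.in_set => /asboolP[x <-] /asboolP[x2 <-].
by apply/asboolP; exists (x * x2); rewrite gmulfM.
Qed.
Canonical hom_image_group := Group hom_image_group_set.

Definition corestriction (x : H) : (subg_of hom_image_group) := subg hom_image (psi x).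

Fact corestrictionM : {morph corestriction : x y / x * y}.
Proof. by move=> x y; rewrite /corestriction gmulfM subgM ?mem_hom_image. Qed.
HB.instance Definition _ := isMultiplicative.Build H (subg_of hom_image_group)
  corestriction corestrictionM.

Lemma sgval_corestriction x : sgval (corestriction x) = psi x.
Proof. by rewrite subgK ?mem_hom_image. Qed.

Lemma corestriction_surj y : exists x, corestriction x = y.
Proof.
have := subgP y; rewrite finset.in_set => /asboolP[x xy]; exists x.
by apply: val_inj; rewrite /= -[LHS]/(sgval _) sgval_corestriction xy.
Qed.
End HomImage.

Lemma pow_pgroup p (F : finGroupType) :
  prime p -> (forall x : F, exists k, x ^+ (p ^ k) = 1) -> p.-group [set: F].
Proof.
move=> p_pr Fp; rewrite /pgroup; apply/pnatP => [|q q_pr].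
  exact: cardG_gt0.
move=> /(Cauchy q_pr)[x _ xq]; have [k /eqP] := Fp x.
rewrite -order_dvdn xq Euclid_dvdX // => /andP[+ _].
by rewrite dvdn_prime2 // inE.
Qed.

Section Levels.
Variables (Gamma : simplicial_graph) (two : bool).
Local Notation V := {classic (vertex Gamma)}.
Local Notation G := (right_angled_coxeter_group Gamma).

(** With [two] false the field [lclass] is vacuous, so both classes of finite groups are covered. *)
Record level := Level {
  lgrp : finGroupType;
  lhom :> {multiplicative G -> lgrp};
  lclass : two -> 2.-group [set: lgrp]
}.

Section Pair.
Variables b1 b2 : level.

Definition pair_hom (x : G) : lgrp b1 * lgrp b2 := (b1 x, b2 x).
Fact pair_homM : {morph pair_hom : x y / x * y}.
Proof. by move=> x y; rewrite /pair_hom !gmulfM. Qed.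
HB.instance Definition _ := isMultiplicative.Build G _ pair_hom pair_homM.

Fact pair_level_class : two -> 2.-group [set: (lgrp b1 * lgrp b2)%type].
Proof.
move=> t; have := lclass b1 t; have := lclass b2 t.
rewrite /pgroup !cardsT card_prod => p2 p1.
by rewrite pnatM p1 p2.
Qed.
Definition pair_level : level := Level pair_hom pair_level_class.

Lemma pair_levelE x y : pair_level x = pair_level y <-> b1 x = b1 y /\ b2 x = b2 y.
Proof. by split=> [[-> ->]|[e1 e2]] //=; rewrite /pair_hom e1 e2. Qed.
End Pair.

Definition pull_level (b : level) (U : pred V) : level :=
  @Level (lgrp b) (b \o retr U) (@lclass b).

(** The target [F] need not be a 2-group, so it is cut down to the image; by Cauchy, 2-power orders
    of the elements suffice there. *)
Fact image_level_class (F : finGroupType) (psi : {multiplicative G -> F}) :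
  (two -> forall x, exists k, psi x ^+ (2 ^ k) = 1) ->
  two -> 2.-group [set: subg_of (hom_image_group psi)].
Proof.
move=> H2 t; apply: pow_pgroup => // y.
have [x <-] := corestriction_surj y; have [k xk] := H2 t x; exists k.
have pE n : corestriction psi x ^+ n = corestriction psi (x ^+ n).
  elim: n => [|n IH]; first by rewrite !expg0 hom1.
  by rewrite !expgS IH gmulfM.
have qE n : psi x ^+ n = psi (x ^+ n).
  elim: n => [|n IH]; first by rewrite !expg0 hom1.
  by rewrite !expgS IH gmulfM.
by apply: val_inj; rewrite pE /= -/(sgval _) sgval_corestriction -qE xk.
Qed.

Definition image_level (F : finGroupType) (psi : {multiplicative G -> F}) H2 :=
  Level (@corestriction _ _ psi) (@image_level_class F psi H2).

Definition trivial_hom (x : G) : {perm bool} := 1.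
Fact trivial_homM : {morph trivial_hom : x y / x * y}.
Proof. by move=> x y; rewrite /trivial_hom mulg1. Qed.
HB.instance Definition _ := isMultiplicative.Build G {perm bool}
  trivial_hom trivial_homM.

Fact trivial_hom_class : two -> forall x, exists k, trivial_hom x ^+ (2 ^ k) = 1.
Proof. by move=> _ x; exists 0; rewrite expg1. Qed.

Definition trivial_level : level := image_level trivial_hom_class.

Lemma image_levelE F psi H2 x y :
  @image_level F psi H2 x = image_level H2 y -> psi x = psi y.
Proof. by move=> /(congr1 sgval); rewrite !sgval_corestriction. Qed.
End Levels.

(** * Magnus coefficients and their trace *)

Section Action.
Variables (Gamma : simplicial_graph) (Z : Type).
Local Notation V := {classic (vertex Gamma)}.
Local Notation G := (right_angled_coxeter_group Gamma).
Variable act : V -> Z -> Z.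
Hypothesis act_inv : forall v, involutive (act v).
Hypothesis act_comm : forall u v, adj u v -> act u \o act v =1 act v \o act u.

(** Exponent signs of letters are ignored, as generators act by involutions. *)
Definition racg_act (g : G) (z : Z) : Z :=
  foldr (fun (l : vertex Gamma * bool) => act l.1) z (repr g : word Gamma).

Fact word_actE u v : word_equiv (@racg_rel Gamma) u v ->
  forall z, foldr (fun (l : vertex Gamma * bool) => act l.1) z u
          = foldr (fun (l : vertex Gamma * bool) => act l.1) z v.
Proof.
elim=> {u v} [//|u v _ IH z|u v w _ IH1 _ IH2 z|u u' v v' _ IH1 _ IH2 z|x b z|].
- by rewrite IH.
- by rewrite IH1.
- by rewrite !foldr_cat IH2 IH1.
- exact: act_inv.
by move=> _ _ [v|u v uv] z; [apply: act_inv | apply/act_comm/asboolP].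
Qed.

Lemma racg_act_pi (w : word Gamma) z :
  racg_act (\pi_(presented_group (@racg_rel Gamma))%qT w) z
  = foldr (fun (l : vertex Gamma * bool) => act l.1) z w.
Proof. exact/word_actE/word_equiv_repr. Qed.

Lemma racg_act1 z : racg_act 1 z = z.
Proof. exact: racg_act_pi. Qed.

Lemma racg_actM x y z : racg_act (x * y) z = racg_act x (racg_act y z).
Proof. by rewrite [LHS]racg_act_pi foldr_cat. Qed.

Lemma racg_act_gen v z : racg_act (gen v) z = act v z.
Proof. exact: racg_act_pi. Qed.

End Action.

(** * Words cut at the occurrences of a vertex [s] *)

Section Syllables.
Variables (Gamma : simplicial_graph).
Local Notation V := {classic (vertex Gamma)}.
Local Notation G := (right_angled_coxeter_group Gamma).
Variable s : V.

(** The product a1 s a2 s ... ak s; a factor after the last [s] is kept apart, as the [z] of later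
    statements. *)
Definition cprod (l : seq G) : G := foldr (fun a z => a * (gen s * z)) 1 l.

(* The initial segments of [cprod l] ending just before the factors [gen s]. *)
Fixpoint prefs (l : seq G) : seq G :=
  if l is a :: l' then a :: [seq a * (gen s * z) | z <- prefs l'] else [::].

Lemma cprod_consM a l z : cprod (a :: l) * z = a * (gen s * (cprod l * z)).
Proof. by rewrite /= -!mulgA. Qed.

Lemma size_prefs l : size (prefs l) = size l.
Proof. by elim: l => //= a l IH; rewrite size_map IH. Qed.

Lemma cprod_cat l l' : cprod (l ++ l') = cprod l * cprod l'.
Proof. by elim: l => [|a l IH] /=; rewrite ?mul1g // IH !mulgA. Qed.

Lemma prefs_cat l l' : prefs (l ++ l') = prefs l ++ [seq cprod l * z | z <- prefs l'].
Proof.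
elim: l => [|a l IH] /=; first by rewrite -[LHS]map_id; apply: eq_map => z; rewrite mul1g.
rewrite IH map_cat -map_comp; congr (_ :: (_ ++ _)).
by apply: eq_map => z /=; rewrite !mulgA.
Qed.

Lemma parab_cprod U l : parab U (gen s) -> (forall a, a \in l -> parab U a) ->
  parab U (cprod l).
Proof.
move=> Us; elim: l => [|a l IH] Ul; first exact: parab1.
apply: parabM; first by apply/Ul/mem_head.
by apply/parabM/IH => // c cl; apply: Ul; rewrite inE cl orbT.
Qed.

Lemma parab_prefs U l : parab U (gen s) -> (forall a, a \in l -> parab U a) ->
  forall a, a \in prefs l -> parab U a.
Proof.
move=> Us; elim: l => [|a l IH] Ul //= c; rewrite inE => /predU1P[->|].
  by apply/Ul/mem_head.
case/mapP => d dl ->; apply: parabM; first by apply/Ul/mem_head.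
by apply/parabM/IH => // e el; apply: Ul; rewrite inE el orbT.
Qed.
End Syllables.

(* Magnus embedding relative to a finite quotient b: the letter s is sent to
   (1 + X) b(s) in the algebra over F_2 generated by the group [lgrp b] and a
   letter X with X^2 = 0 that commutes with the image H of the star of s, every
   other letter v is sent to b(v). A monomial of degree k is encoded by the k
   cosets of H at which its letters X occur; its remaining factor in [lgrp b] is
   known from the level. [coefs] are families of coefficients on which the group
   acts by left multiplication, and [trunc] discards degrees above N. *)
Section Magnus.
Variables (Gamma : simplicial_graph) (two : bool).
Local Notation V := {classic (vertex Gamma)}.
Local Notation G := (right_angled_coxeter_group Gamma).
Variables (b : level Gamma two) (s : V).
Local Notation P := (lgrp b).
Local Notation Y := {set P}.

Definition star : pred V := fun v => adj s v || (v == s).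
Definition star_img : Y := [set y : P | `[< exists2 x, parab star x & b x = y >]].
Local Notation H := star_img.

Lemma star_imgP y : reflect (exists2 x, parab star x & b x = y) (y \in H).
Proof. by rewrite finset.in_set; apply: asboolP. Qed.

Lemma star_img1 : 1 \in H.
Proof. by apply/star_imgP; exists 1; [apply: parab1 | rewrite hom1]. Qed.

Definition lact (p : P) (h : Y) : Y := p *: h.
Local Notation "p *! h" := (lact p h) (at level 40, left associativity).

Lemma mem_lact p h y : (y \in p *! h) = (p^-1 * y \in h).
Proof. exact: mem_lcoset. Qed.

Lemma lact1 (h : Y) : 1 *! h = h.
Proof. by apply/setP => y; rewrite mem_lact invg1 mul1g. Qed.

Lemma lactM (p q : P) (h : Y) : (p * q) *! h = p *! (q *! h).
Proof. by apply/setP => y; rewrite !mem_lact invgM mulgA. Qed.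

Lemma lactK (p : P) : cancel (fun h : Y => p *! h) (fun h => p^-1 *! h).
Proof. by move=> h; rewrite -lactM mulVg lact1. Qed.

Lemma lactKV (p : P) : cancel (fun h : Y => p^-1 *! h) (fun h => p *! h).
Proof. by move=> h; rewrite -lactM mulgV lact1. Qed.

Lemma lactE (p : P) (h : Y) : p^-1 *! (p *! h) = h. Proof. exact: lactK. Qed.

Lemma lact_inj (p : P) : injective (fun h : Y => p *! h).
Proof.
by apply: (can_inj (g := fun h => p^-1 *! h)) => h; rewrite -lactM mulVg lact1.
Qed.

Lemma star_imgM x : parab star x -> b x *! H = H.
Proof.
move=> sx; apply/setP => y; rewrite mem_lact.
apply/star_imgP/star_imgP => -[z sz zy].
  by exists (x * z); [apply: parabM | rewrite gmulfM zy mulVKg].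
exists (x^-1 * z); first by apply: parabM => //; apply: parabV.
by rewrite gmulfM homV zy.
Qed.

Lemma star_gen v : star v -> b (gen v) *! H = H.
Proof. by move=> sv; apply/star_imgM/parab_gen. Qed.

Lemma lcoset_star_img x y :
  b x *! H = b y *! H -> exists2 z, parab star z & b x = b (y * z).
Proof.
move=> xy; have : b x \in b y *! H.
  by rewrite -xy mem_lact mulVg star_img1.
rewrite mem_lact => /star_imgP[z sz zE].
by exists z => //; rewrite gmulfM zE mulVKg.
Qed.

Local Notation coefs := (seq Y -> bool).

Definition shift (p : P) (c : coefs) : coefs :=
  fun hs => c [seq p^-1 *! h | h <- hs].
Definition addc (c d : coefs) : coefs := fun hs => c hs (+) d hs.
(** Left multiplication by X. Cosets are absolute positions, so X prepends [H] and leaves the others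
    in place; the test on [ohead hs'] expresses X h X = 0 for h in [H]. *)
Definition mulX (c : coefs) : coefs := fun hs =>
  if hs is h :: hs' then [&& h == H, ohead hs' != Some H & c hs'] else false.

Lemma shiftM p q c : shift (p * q) c = shift p (shift q c).
Proof.
apply: funext => hs; rewrite /shift -map_comp; congr c.
by apply: eq_map => h /=; rewrite invgM lactM.
Qed.

Lemma shift1 c : shift 1 c = c.
Proof.
apply: funext => hs; rewrite /shift -[in RHS](map_id hs); congr c.
by apply: eq_map => h; rewrite invg1 lact1.
Qed.

Lemma shift_add p c d : shift p (addc c d) = addc (shift p c) (shift p d).
Proof. by []. Qed.

Lemma mulX_add c d : mulX (addc c d) = addc (mulX c) (mulX d).
Proof.
apply: funext => -[|h hs] //=; rewrite /addc /=.
by case: (h == H) => //=; case: (_ != _).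
Qed.

Lemma mulXX c : mulX (mulX c) = fun=> false.
Proof.
apply: funext => -[|h [|h' hs]] //=; first by rewrite andbF.
by rewrite (inj_eq (@Some_inj _)); case: (h' == H); rewrite ?andbF.
Qed.

Lemma shift_mulX p c : p *! H = H -> shift p (mulX c) = mulX (shift p c).
Proof.
move=> pH; have p'H : p^-1 *! H = H by rewrite -{1}pH -lactM mulVg lact1.
have pE h : (p^-1 *! h == H) = (h == H).
  by rewrite -{1}p'H (inj_eq (@lact_inj _)).
apply: funext => -[|h hs] //; rewrite /shift /= pE; congr (_ && (_ && _)).
by case: hs => //= h' hs; rewrite !(inj_eq (@Some_inj _)) pE.
Qed.

Definition magnus_gen (v : V) (c : coefs) : coefs :=
  let c' := shift (b (gen v)) c in if v == s then addc c' (mulX c') else c'.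

Lemma star_self : star s. Proof. by rewrite /star eqxx orbT. Qed.

(** In characteristic 2 the square of (1 + X) b(s) is 1, as X^2 = 0 and b(s) commutes with X. *)
Fact magnus_gen_inv v : involutive (magnus_gen v).
Proof.
have sqE c : shift (b (gen v)) (shift (b (gen v)) c) = c.
  by rewrite -shiftM -gmulfM gen_sq hom1 shift1.
move=> c; rewrite /magnus_gen; case: eqP => [vs|_]; last by rewrite sqE.
have vH : b (gen v) *! H = H by rewrite vs; apply/star_gen/star_self.
rewrite shift_add shift_mulX // !sqE mulX_add mulXX.
apply: funext => hs; rewrite /addc addbF -addbA addbb addbF //.
Qed.

Fact magnus_gen_comm u v : adj u v ->
  magnus_gen u \o magnus_gen v =1 magnus_gen v \o magnus_gen u.
Proof.
have aux x y c : adj x y -> x = s ->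
  magnus_gen x (magnus_gen y c) = magnus_gen y (magnus_gen x c).
  move=> xy xs; rewrite /magnus_gen xs eqxx.
  have -> : (y == s) = false by apply/eqP => ys; rewrite xs ys adj_irr in xy.
  rewrite shift_add shift_mulX; last first.
    by apply: star_gen; rewrite /star -xs xy.
  by rewrite -!shiftM -!gmulfM -xs (gen_comm xy).
move=> uv c /=; case: (eqVneq u s) => [us|us]; first exact: aux.
case: (eqVneq v s) => [vs|vs]; first by rewrite -aux // adj_sym.
rewrite /magnus_gen (negbTE us) (negbTE vs).
by rewrite -!shiftM -!gmulfM (gen_comm uv).
Qed.

Local Notation mact := (racg_act magnus_gen).
Let mactM := racg_actM magnus_gen_inv magnus_gen_comm.
Let mact1 := racg_act1 magnus_gen_inv magnus_gen_comm.
Let mact_gen := racg_act_gen magnus_gen_inv magnus_gen_comm.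

Lemma mact_trunc N g (c d : coefs) :
  (forall hs, size hs <= N -> c hs = d hs) ->
  forall hs, size hs <= N -> mact g c hs = mact g d hs.
Proof.
move=> cd; elim/racg_ind: g => [|v g IH] hs hsN; first by rewrite !mact1 cd.
rewrite !mactM !mact_gen /magnus_gen.
have IH' hs' : size hs' <= N -> shift (b (gen v)) (mact g c) hs'
    = shift (b (gen v)) (mact g d) hs'.
  by move=> H'; apply: IH; rewrite size_map.
case: (v == s); last exact: IH'.
rewrite /addc IH' //; congr (_ (+) _); case: hs hsN => //= h hs hsN.
by rewrite IH' // ltnW.
Qed.

Lemma mact_add g c d : mact g (addc c d) = addc (mact g c) (mact g d).
Proof.
elim/racg_ind: g => [|v g IH]; first by rewrite !mact1.
rewrite !mactM !mact_gen IH /magnus_gen shift_add; case: (v == s) => //.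
by rewrite mulX_add; apply: funext => hs; rewrite /addc addbACA.
Qed.

Lemma mact_lead g i (c : coefs) : (forall hs, size hs < i -> c hs = false) ->
  forall hs, size hs <= i -> mact g c hs = shift (b g) c hs.
Proof.
move=> ci; elim/racg_ind: g => [|v g IH] hs hsi.
  by rewrite mact1 hom1 shift1.
rewrite mactM mact_gen /magnus_gen gmulfM shiftM.
have IH' hs' : size hs' <= i ->
    shift (b (gen v)) (mact g c) hs' = shift (b (gen v)) (shift (b g) c) hs'.
  by move=> H'; apply: IH; rewrite size_map.
case: (v == s); last exact: IH'.
rewrite /addc IH' // -[RHS]addbF; congr (_ (+) _).
case: hs hsi => //= h hs hsi.
by rewrite IH' 1?ltnW // /shift ci ?size_map ?andbF.
Qed.

(** Each squaring gains a degree: if w fixes c up to degree i + j, then d = w c + c starts above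
    that degree, so w fixes d in degree i + j + 1, which reads w^2 c = c there. *)
Lemma mact_unipotent z j i (c : coefs) : b z = 1 ->
  (forall hs, size hs < i -> c hs = false) ->
  forall hs, size hs <= i + j -> mact (z ^+ (2 ^ j)) c hs = c hs.
Proof.
move=> bz; elim: j => [|j IH] in i c * => ci hs hsi.
  by rewrite expg1 (mact_lead z ci) -1?[i]addn0 // bz shift1.
set w := z ^+ (2 ^ j) in IH.
have wE : z ^+ (2 ^ j.+1) = w * w.
  by rewrite /w -expgnDr addnn -mul2n -expnS.
pose d := addc (mact w c) c.
have di hs' : size hs' < (i + j).+1 -> d hs' = false.
  by move=> H'; rewrite /d /addc (IH i) // addbb.
have := IH _ _ di hs; rewrite /d mact_add -mactM -wE => E.
have {}E := E (leq_trans hsi _); rewrite addnS in E.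
have /E : (i + j).+1 <= (i + j).+1 + j by rewrite leq_addr.
rewrite /addc; set X := mact w c hs; case: (mact _ c hs); case: (c hs); case: X => //.
Qed.

Section Truncation.
Variable N : nat.
Local Notation Z := {ffun N.-bseq Y -> bool}.

Definition trunc (c : coefs) : Z := [ffun hs : N.-bseq Y => c hs].
Definition untrunc (c : Z) : coefs := fun hs => if insub hs is Some t then c t else false.

Lemma untruncK : cancel untrunc trunc.
Proof. by move=> c; apply/ffunP => t; rewrite ffunE /untrunc valK. Qed.

Lemma truncP (c d : coefs) :
  trunc c = trunc d <-> forall hs, size hs <= N -> c hs = d hs.
Proof.
split=> [/ffunP cd hs hsN|cd]; first by have := cd (Bseq hsN); rewrite !ffunE.
by apply/ffunP => t; rewrite !ffunE cd // size_bseq.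
Qed.

Lemma trunc_mact g c : trunc (mact g (untrunc (trunc c))) = trunc (mact g c).
Proof.
by apply/truncP/mact_trunc => hs hsN; apply/truncP: hs hsN; rewrite untruncK.
Qed.

Fact magnus_perm_inj g : injective (fun c : Z => trunc (mact g^-1 (untrunc c))).
Proof.
apply: (can_inj (g := fun c : Z => trunc (mact g (untrunc c)))) => c.
by rewrite trunc_mact -mactM mulgV mact1 untruncK.
Qed.

(* Permutations compose from left to right, hence the inverse. *)
Definition magnus_perm (g : G) : {perm Z} := perm (@magnus_perm_inj g).

Fact magnus_permM : {morph magnus_perm : x y / x * y}.
Proof.
move=> x y; apply/permP => c.
by rewrite permM !permE trunc_mact invgM mactM.
Qed.
HB.instance Definition _ := isMultiplicative.Build G {perm Z}
  magnus_perm magnus_permM.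

Fact magnus_perm_class :
  two -> forall x, exists k, magnus_perm x ^+ (2 ^ k) = 1.
Proof.
move=> t x; have /p_natP[k kE] := lclass b t.
have bx : b (x ^+ (2 ^ k)) = 1.
  have -> : b (x ^+ (2 ^ k)) = (b x) ^+ (2 ^ k).
    by elim: (2 ^ k)%N => [|n IH]; rewrite ?expg0 ?hom1 // !expgS gmulfM IH.
  by rewrite -kE; apply: expg_cardG; rewrite finset.in_setT.
(* [k] squarings bring [x] into the kernel of [b], and [N] more make it act trivially up to degree
   [N]. *)
exists (k + N).
have -> : magnus_perm x ^+ (2 ^ (k + N)) = magnus_perm (x ^+ (2 ^ k) ^+ (2 ^ N)).
  rewrite -expgnA -expnD; elim: (2 ^ _)%N => [|n IH].
    by rewrite !expg0 (hom1 magnus_perm).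
  by rewrite !expgS magnus_permM IH.
apply/permP => c; rewrite permE perm1 -[RHS]untruncK; apply/truncP => hs hsN.
rewrite -expVgn (@mact_unipotent _ _ 0) //.
by rewrite homV bx invg1.
Qed.

Definition magnus_level : level Gamma two := image_level magnus_perm_class.
End Truncation.

Definition delta : coefs := fun hs => nilp hs.
Definition coef (g : G) : coefs := mact g delta.

Lemma magnus_levelP N x y : magnus_level N x = magnus_level N y ->
  forall hs, size hs <= N -> coef x hs = coef y hs.
Proof.
move=> /image_levelE /(congr1 invg) xy; apply/truncP.
have : magnus_perm N x^-1 = magnus_perm N y^-1 by rewrite !homV.
by move=> /permP/(_ (trunc N delta)); rewrite !permE !invgK !trunc_mact.
Qed.

Lemma coef1 : coef 1 = delta.
Proof. exact: mact1. Qed.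

Lemma coefM x y : coef (x * y) = mact x (coef y).
Proof. exact: mactM. Qed.

Local Notation noS := (parab (fun v => v != s)).
Local Notation neq := (fun h h' : Y => h != h').
Local Notation sigma := (b (gen s)).

Lemma mact_noS x c : noS x -> mact x c = shift (b x) c.
Proof.
move: x; apply: parab_ind => [|v x vs xs IH]; first by rewrite mact1 hom1 shift1.
by rewrite mactM mact_gen IH /magnus_gen (negbTE vs) gmulfM shiftM.
Qed.

Lemma shift_delta p : shift p delta = delta.
Proof. by apply: funext => -[]. Qed.

Lemma coef_noS x : noS x -> coef x = delta.
Proof. by move=> xS; rewrite /coef mact_noS // shift_delta. Qed.

Lemma coef_noSM x g : noS x -> coef (x * g) = shift (b x) (coef g).
Proof. by move=> xS; rewrite coefM mact_noS. Qed.

Lemma coef_sM g :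
  coef (gen s * g) = addc (shift sigma (coef g)) (mulX (shift sigma (coef g))).
Proof. by rewrite coefM mact_gen /magnus_gen eqxx. Qed.

(** The top monomial of [cprod s l], obtained by choosing X in every factor (1 + X) b(s). *)
Definition walls (l : seq G) : seq Y := [seq b z *! H | z <- prefs s l].

Arguments walls : simpl never.

Lemma walls_cons a l :
  walls (a :: l) = b a *! H :: [seq b a *! (sigma *! h) | h <- walls l].
Proof.
rewrite /walls /= -!map_comp; congr (_ :: _); apply: eq_map => z /=.
by rewrite !gmulfM !lactM.
Qed.

Lemma size_walls l : size (walls l) = size l.
Proof. by rewrite size_map size_prefs. Qed.

Lemma map_lactKK (p q : P) (hs : seq Y) :
  [seq q^-1 *! h | h <- [seq p^-1 *! h | h <- [seq p *! (q *! h) | h <- hs]]] = hs.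
Proof.
by rewrite -!map_comp -[RHS]map_id; apply: eq_map => h /=; rewrite !lactK.
Qed.

Lemma coef_big l z hs : (forall a, a \in l -> noS a) -> noS z ->
  size l < size hs -> coef (cprod s l * z) hs = false.
Proof.
elim: l hs => [|a l IH] hs lS zS.
  by rewrite mul1g coef_noS //; case: hs.
have aS : noS a by apply/lS/mem_head.
have {}IH hs' := IH hs' (fun c cl => lS c (@mem_behead _ (a :: l) c cl)) zS.
rewrite cprod_consM coef_noSM // coef_sM /shift /addc /mulX.
case: hs => //= h hs lhs; rewrite IH /= ?size_map; last exact: ltnW.
by rewrite IH /= ?size_map // !andbF.
Qed.

(** Degree [size l] is reached only by choosing X at every occurrence of [s], which leaves a single
    monomial. *)
Lemma coef_top l z hs : (forall a, a \in l -> noS a) -> noS z ->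
  size hs = size l -> coef (cprod s l * z) hs -> hs = walls l.
Proof.
elim: l hs => [|a l IH] hs lS zS; first by case: hs.
have aS : noS a by apply/lS/mem_head.
have lS' c : c \in l -> noS c := fun cl => lS c (@mem_behead _ (a :: l) c cl).
rewrite cprod_consM coef_noSM // coef_sM /shift /addc /mulX.
case: hs => //= h hs [lhs]; rewrite coef_big ?addFb //= ?size_map ?lhs //.
case/and3P => /eqP hH _ /IH {}IH; rewrite walls_cons -hH lactKV -IH //.
  rewrite -!map_comp; congr (_ :: _); rewrite -[LHS]map_id; apply: eq_map => y /=.
  by rewrite !lactKV.
by rewrite !size_map.
Qed.

(** The relation X^2 = 0 kills the top monomial only when two consecutive cosets coincide. *)
Lemma coef_walls l z : (forall a, a \in l -> noS a) -> noS z ->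
  sorted neq (walls l) -> coef (cprod s l * z) (walls l).
Proof.
elim: l => [|a l IH] lS zS; first by rewrite mul1g coef_noS.
have aS : noS a by apply/lS/mem_head.
have lS' c : c \in l -> noS c := fun cl => lS c (@mem_behead _ (a :: l) c cl).
rewrite cprod_consM coef_noSM // coef_sM /shift /addc /mulX walls_cons /= => sl.
rewrite coef_big //= ?size_map ?size_walls ?size_prefs // lactE eqxx /=.
rewrite map_lactKK IH //; last first.
  have inj : injective (fun h : Y => b a *! (sigma *! h)).
    by move=> h h' /lact_inj/lact_inj.
  move: (path_sorted sl); rewrite sorted_map.
  by apply: sub_sorted => h h' /=; rewrite (inj_eq inj).
rewrite andbT; move: sl; case: (walls l) => //= h hs /andP[+ _].
by apply: contraNneq => -[<-]; rewrite lactKV.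
Qed.

Definition separated a : Prop := forall z, parab star z -> b a <> b z.

(** Consecutive walls coincide exactly when the syllable between the two letters [s] maps into [H];
    the first syllable is between no two letters, hence [behead]. *)
Lemma sorted_walls l :
  (forall a, a \in behead l -> separated a) -> sorted neq (walls l).
Proof.
elim: l => [|a l IH] Hl; first by [].
case: l => [|a' l] in IH Hl *; first by [].
have inj : injective (fun h : Y => b a *! (sigma *! h)).
  by move=> h h' /lact_inj/lact_inj.
have sl : sorted neq (walls (a' :: l)).
  by apply: IH => c cl; apply: Hl; rewrite inE cl orbT.
rewrite walls_cons.
have -> : sorted neq (b a *! H :: [seq b a *! (sigma *! h) | h <- walls (a' :: l)])
    = path neq (b a *! H) [seq b a *! (sigma *! h) | h <- walls (a' :: l)] by [].
move: sl; rewrite walls_cons /= => sl; apply/andP; split.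
  apply/eqP => /lact_inj; rewrite -lactM -gmulfM -{1}[H]lact1 -(hom1 b).
  case/esym/lcoset_star_img => x sx; rewrite mul1g => xE.
  apply: (Hl a' (mem_head _ _) (gen s * x)).
    by apply: parabM => //; apply/parab_gen/star_self.
  by rewrite gmulfM -xE -gmulfM genK.
apply: (@homo_path _ _ (fun h => b a *! (sigma *! h)) neq _ _ _ _ sl) => h h'.
by rewrite (inj_eq inj).
Qed.

(* Twisted rotation: the effect on the cosets of conjugating a monomial with
   group part p by its first letter X. *)
Definition rotw (p : P) (hs : seq Y) : seq Y :=
  if hs is h :: t then rcons t (p *! h) else [::].

(** The last coset is also compared with the first one moved by [p]. In degree at most one no two
    letters X can collide, so nothing is required. *)
Definition cycred (p : P) (hs : seq Y) : bool :=
  (size hs <= 1) || (if hs is h :: t then path neq h (rcons t (p *! h)) else true).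

Lemma cycred_rot p hs : cycred p (rotw p hs) = cycred p hs.
Proof.
case: hs => // h [|h' t] //=; rewrite /cycred /= size_rcons /=.
by rewrite [LHS]rcons_path last_rcons (inj_eq (@lact_inj p)) andbC.
Qed.

Lemma mem_iter_rot p i hs h :
  h \in hs -> exists m, p ^+ m *! h \in iter i (rotw p) hs.
Proof.
elim: i => [|i IH] hhs; first by exists 0; rewrite expg0 lact1.
have [m] := IH hhs; rewrite /=; case: (iter i _ hs) => //= y t.
rewrite inE => /predU1P[<-|ht].
  by exists m.+1; rewrite mem_rcons inE expgS lactM eqxx.
by exists m; rewrite mem_rcons inE ht orbT.
Qed.

Lemma mem_iter_rotV p i hs y :
  y \in iter i (rotw p) hs -> exists2 h, h \in hs & exists m, y = p ^+ m *! h.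
Proof.
elim: i y => [|i IH] y; first by exists y => //; exists 0; rewrite expg0 lact1.
rewrite /=; case: (iter i _ hs) IH => //= z t IH.
rewrite mem_rcons inE => /predU1P[->|yt].
  have [h hhs [m zE]] := IH z (mem_head _ _).
  by exists h => //; exists m.+1; rewrite zE expgS lactM.
by apply: IH; rewrite inE yt orbT.
Qed.

Lemma map_rot p q hs : [seq q *! h | h <- rotw p hs]
  = rotw (q * p * q^-1) [seq q *! h | h <- hs].
Proof.
case: hs => //= h t; rewrite map_rcons; congr (rcons _ _).
by rewrite -!lactM mulgVK.
Qed.

Lemma map_cycred p q hs :
  cycred (q * p * q^-1) [seq q *! h | h <- hs] = cycred p hs.
Proof.
rewrite /cycred size_map; case: hs => //= h t; congr (_ || _).
rewrite -lactM mulgVK lactM -(map_rcons (fun h => q *! h)) (@path_map _ _ (fun h => q *! h)).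
by apply: eq_path => x y /=; rewrite (inj_eq (@lact_inj q)).
Qed.

(* Right multiplication by p X p^-1. *)
Definition appX (p : P) (c : coefs) : coefs := fun hs =>
  if rev hs is h :: r then [&& h == p *! H, ohead r != Some (p *! H) & c (rev r)]
  else false.

Lemma appX_rcons p c t h :
  appX p c (rcons t h) = [&& h == p *! H, ohead (rev t) != Some (p *! H) & c t].
Proof. by rewrite /appX rev_rcons revK. Qed.

Lemma shift_appX q p c : shift q (appX p c) = appX (q * p) (shift q c).
Proof.
apply: funext => hs; case/lastP: hs => // t h.
rewrite /shift map_rcons !appX_rcons -map_rev lactM.
rewrite (can2_eq (@lactKV q) (@lactK q)); congr (_ && (_ && _)).
case: (rev t) => //= y r.
by rewrite !(inj_eq (@Some_inj _)) (can2_eq (@lactKV q) (@lactK q)).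
Qed.

Lemma mulX_appX p c : mulX (appX p c) = appX p (mulX c).
Proof.
apply: funext => -[|h hs]; first by [].
case/lastP: hs => [|t h'].
  by rewrite -[[:: h]]/(rcons [::] h) appX_rcons /= /appX /= !andbF.
rewrite -rcons_cons appX_rcons rcons_cons /= appX_rcons rev_cons.
case: t => [|y t].
  rewrite /= !(inj_eq (@Some_inj _)).
  case: (h =P H) => [->|_]; last by rewrite !andbF.
  case: (h' =P p *! H) => [->|_]; last by rewrite !andbF.
  by rewrite /= [H == _]eq_sym.
have oE r x : r != [::] -> ohead (rcons r x) = ohead r by case: r.
rewrite !oE //; last by rewrite -size_eq0 size_rev.
by case: (h == H); case: (h' == _); rewrite ?andbF ?andbT //= andbCA.
Qed.

(** Coefficient families omit the final group factor [b g]; moving the new X across it produces b(g)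
    X b(g)^-1. *)
Lemma coefMs g : coef (g * gen s) = addc (coef g) (appX (b g) (coef g)).
Proof.
have X1 : coef (gen s) = addc delta (appX 1 delta).
  rewrite -[gen s]mulg1 coef_sM coef1 shift_delta; congr addc.
  apply: funext => -[|h hs] //; case/lastP: hs => [|t h'].
    by rewrite -[[:: h]]/(rcons [::] h) appX_rcons /= lact1.
  by rewrite -rcons_cons appX_rcons /= !andbF; case: t => //= *; rewrite !andbF.
have actX x p c : mact x (appX p c) = appX (b x * p) (mact x c).
  elim/racg_ind: x => [|v x IH]; first by rewrite !mact1 hom1 mul1g.
  rewrite !mactM !mact_gen IH /magnus_gen shift_appX mulgA -gmulfM.
  case: (v == s) => //; rewrite mulX_appX; apply: funext => hs.
  rewrite /addc; case/lastP: hs => // t h; rewrite !appX_rcons.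
  by rewrite /addc; case: (_ == _); case: (_ != _).
by rewrite coefM X1 mact_add actX mulg1.
Qed.

(** * Conjugation invariance of the trace *)

Section Trace.
Variable n : nat.
Implicit Types C : pred (seq Y).

(* The trace: a sum of top-degree coefficients over a class of monomials that is
   stable under cyclic rotation is invariant under conjugation. *)
Definition tau C g : bool := \big[addb/false]_(t : n.+1.-tuple Y | C t) coef g t.

Definition rot_stable p C : Prop := forall hs : seq Y, size hs = n.+1 ->
  C (rotw p hs) = C hs /\ (C hs -> cycred p hs).

Definition lact_tuple p (t : n.+1.-tuple Y) : n.+1.-tuple Y :=
  map_tuple (fun h => p *! h) t.

Lemma lact_tuple_inj p : injective (lact_tuple p).
Proof.
by move=> t u /(congr1 val) /(inj_map (@lact_inj p)) /val_inj.
Qed.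

Definition rot_tuple p (t : n.+1.-tuple Y) : n.+1.-tuple Y :=
  rcons_tuple (behead_tuple t) (p *! thead t).

Lemma rot_tupleE p t : tval (rot_tuple p t) = rotw p t.
Proof. by case/tupleP: t => h t; rewrite /= theadE. Qed.

Lemma rotw_inj p : injective (rotw p).
Proof.
move=> [|h t] [|h' t'] //= e; try by case: t e || case: t' e.
by have /rcons_inj[-> /lact_inj ->] := e.
Qed.

Lemma rot_tuple_inj p : injective (rot_tuple p).
Proof.
by move=> t u /(congr1 (@tval _ _)); rewrite !rot_tupleE => /rotw_inj /val_inj.
Qed.

Lemma rot_stable_lact q p C : rot_stable (q * p * q^-1) C ->
  rot_stable p (fun hs => C [seq q *! h | h <- hs]).
Proof.
move=> CP hs hsn; have [] := CP [seq q *! h | h <- hs]; first by rewrite size_map.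
by rewrite -map_rot map_cycred.
Qed.

Lemma tau_lact q C (F : pred (n.+1.-tuple Y)) :
  \big[addb/false]_(t : n.+1.-tuple Y | C (t : seq Y)) F t
  = \big[addb/false]_(t : n.+1.-tuple Y | C [seq q *! h | h <- t]) F (lact_tuple q t).
Proof. exact: (reindex_inj (@lact_tuple_inj q)). Qed.

Lemma shift_lact_tuple q c t : shift q c (lact_tuple q t) = c t.
Proof.
rewrite /shift /= -map_comp -[in RHS](map_id t); congr c.
by apply: eq_map => h /=; rewrite lactE.
Qed.

(** For [v] = [s] the product (1 + X) d (1 + q X q^-1) has four terms: d gives the right-hand side,
    the term with two new X vanishes on cyclically reduced monomials, and the other two cancel
    modulo 2. *)
Lemma tau_gen v C g : rot_stable (b (gen v * g * gen v)) C ->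
  tau C (gen v * g * gen v) = tau (fun hs => C [seq b (gen v) *! h | h <- hs]) g.
Proof.
move=> CP; rewrite -mulgA.
have [vs|vs] := eqVneq v s; last first.
  have vS : noS (gen v) by apply: parab_gen.
  rewrite /tau coef_noSM // coefM (coef_noS vS) -coef1 -coefM mulg1.
  by rewrite (tau_lact (b (gen v))); apply: eq_bigr => t _; apply: shift_lact_tuple.
rewrite {}vs in CP *; set p' := b (gen s * g * gen s) in CP.
pose d := shift sigma (coef g); pose q := sigma * b g.
have qE : p' *! H = q *! H.
  by rewrite /p' gmulfM lactM (star_gen star_self) gmulfM.
have dE : coef (gen s * (g * gen s)) = addc (addc d (appX q d)) (mulX (addc d (appX q d))).
  by rewrite coef_sM coefMs shift_add shift_appX.
have tE (t : n.+1.-tuple Y) : C t ->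
    coef (gen s * (g * gen s)) t = d t (+) (appX q d t (+) mulX d t).
  move=> Ct; rewrite dE mulX_add /addc -addbA; congr (_ (+) (_ (+) _)).
  (* Otherwise [t] would begin with [H] and end with [H] moved by [p'], against cyclic
     reducedness. *)
  suff -> : mulX (appX q d) t = false by rewrite addbF.
  have [_ /(_ Ct)] := CP t (size_tuple t).
  case: t {Ct} => -[|h t] /= _ //; case/lastP: t => [|t h'].
    by rewrite /appX /= !andbF.
  rewrite /cycred /= size_rcons /= !rcons_path last_rcons => /andP[_ h'h].
  rewrite appX_rcons -qE; case: (h =P H) => //= hH; rewrite hH in h'h.
  by rewrite (negbTE h'h) andbF.
rewrite /tau (eq_bigr _ tE) !big_split /=.
(* Rotation carries the monomials that begin with [H] to those that end with [H] moved by [p']. *)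
have -> : \big[addb/false]_(t : n.+1.-tuple Y | C t) appX q d t
        = \big[addb/false]_(t : n.+1.-tuple Y | C t) mulX d t.
  rewrite (reindex_inj (@rot_tuple_inj p')) /=; apply: eq_big => t.
    by rewrite rot_tupleE; have [] := CP t (size_tuple t).
  rewrite rot_tupleE; have [-> Ccyc] := CP t (size_tuple t) => /Ccyc.
  case: t {Ccyc} => -[|h t] /= _ //; rewrite /cycred /= => tcyc.
  rewrite appX_rcons -qE (inj_eq (@lact_inj p')).
  case: eqP => //= hH; rewrite {}hH in tcyc.
case: t tcyc => [|y t] //; rewrite [in rev _]lastI rev_rcons /= rcons_path /=.
  case/and3P=> Hy _ lp; rewrite !(inj_eq (@Some_inj _)) lp.
  by rewrite eq_sym Hy.
rewrite addbb addbF (tau_lact sigma); apply: eq_bigr => t _.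
exact: shift_lact_tuple.
Qed.

Lemma tau_conj x C g : rot_stable (b (x * g * x^-1)) C ->
  tau C (x * g * x^-1) = tau (fun hs => C [seq b x *! h | h <- hs]) g.
Proof.
elim/racg_ind: x => [|v x IH] in C *.
  rewrite mul1g invg1 mulg1 => _; apply: eq_bigl => t; rewrite hom1.
  by rewrite -[X in C X](map_id t); congr C; apply/esym/eq_map => h; apply: lact1.
have -> : gen v * x * g * (gen v * x)^-1 = gen v * (x * g * x^-1) * gen v.
  by rewrite invgM genV !mulgA.
move=> CP; rewrite tau_gen //.
have CP' : rot_stable (b (x * g * x^-1)) (fun hs => C [seq b (gen v) *! h | h <- hs]).
  by apply: rot_stable_lact; rewrite -homV genV -!gmulfM.
rewrite IH //; apply: eq_bigl => t; congr C; rewrite -map_comp.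
by apply: eq_map => h /=; rewrite gmulfM lactM.
Qed.
End Trace.

(* With C the rotation class of the walls of the cyclically reduced word f, only
   the top monomial of f contributes to its trace, so g must have a monomial whose
   translate by x is a rotation of that of f. *)
Lemma cyc_conjugate l l' z' x :
  (forall a, a \in l -> noS a) -> (forall a, a \in l' -> noS a) -> noS z' ->
  (0 < size l) -> size l' <= size l ->
  (1 < size l -> forall a, a \in l -> separated a) ->
  let f := cprod s l in let g := cprod s l' * z' in
  b (f * x) = b (x * g) ->
  magnus_level (size l) (f * x) = magnus_level (size l) (x * g) ->
  exists m k u c, [/\ u \in prefs s l, parab star c &
    b (x * head 1 l') = b (f ^- m * f ^+ k * u * c)].
Proof.
move=> lS l'S z'S l_gt0 l'l lsep f g bfg Nfg.
set N := size l in l_gt0 l'l lsep Nfg.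
have fE : b f = b (x * g * x^-1) by rewrite gmulfM -bfg -gmulfM mulgK.
have cE hs : size hs <= N -> coef f hs = coef (x * g * x^-1) hs.
  move: hs; apply: magnus_levelP; rewrite [RHS]gmulfM -Nfg -gmulfM mulgK //.
have [n Nn] : exists n, N = n.+1 by exists N.-1; rewrite prednK.
pose p := b f; pose w := walls l.
have ws : size w = n.+1 by rewrite size_walls.
have wcyc : cycred p w.
  case: (leqP (size w) 1) => [w1|w2]; first by rewrite /cycred w1.
  have Nsep : 1 < N by rewrite -[N](size_walls l).
  rewrite /cycred; apply/orP; right.
  case El: l => [|a l0]; first by rewrite /N El in l_gt0.
  (* Repeating the first syllable at the end adds a wall equal to [p] times the first one, so
     reducedness of the longer list is cyclic reducedness of [w]. *)
  have sr : sorted neq (walls (l ++ [:: a])).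
    apply: sorted_walls => c; rewrite El /= mem_cat inE => cl.
    by apply: (lsep Nsep); rewrite El inE orbC.
  move: sr; rewrite {1}/walls prefs_cat map_cat /= -/(walls l) -/w cats1.
  rewrite gmulfM lactM -/f -/p -[b a *! H]/(head H (walls (a :: l0))) -El -/w.
  by case: (w).
pose C (hs : seq Y) : bool :=
  `[< exists r r', iter r (rotw p) hs = iter r' (rotw p) w >].
have iterS r (hs : seq Y) : iter r (rotw p) (rotw p hs) = iter r.+1 (rotw p) hs.
  by rewrite iterSr.
have cyc_iter r hs : cycred p (iter r (rotw p) hs) = cycred p hs.
  by elim: r => //= r IH; rewrite cycred_rot.
have CP : rot_stable n p C.
  move=> hs _; split.
    apply/asboolP/asboolP => -[r [r' rE]].
      by exists r.+1, r'; rewrite -iterS.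
    by exists r, r'.+1; rewrite iterS /= rE.
  by case/asboolP => r [r' rE]; rewrite -(cyc_iter r) rE cyc_iter.
have tau1 : tau n C f.
  rewrite /tau (bigD1 (tcast ws (in_tuple w))) /=; last first.
    by apply/asboolP; exists 0, 0; rewrite val_tcast.
  rewrite val_tcast /= big1 => [|t /andP[_ tw]].
    rewrite addbF -[f]mulg1; apply: coef_walls => //; first exact: parab1.
    apply: sorted_walls => a al; apply: lsep; last exact: mem_behead.
    by rewrite /N; case: (l) al => // a' [].
  apply/negbTE; apply: contraNN tw => ct; apply/eqP/val_inj => /=.
  rewrite val_tcast; apply: (@coef_top l 1) => //; first exact: parab1.
    by rewrite size_tuple; apply/esym.
  by rewrite mulg1.
have [t Ct ct] : exists2 t : n.+1.-tuple Y, C [seq b x *! h | h <- t] & coef g t.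
  apply: contrapT => no; suff : tau n C f = false by rewrite tau1.
  have -> : tau n C f = tau n C (x * g * x^-1).
    by apply: eq_bigr => u _; rewrite cE // Nn size_tuple.
  rewrite tau_conj -?fE // /tau big1 // => u Cu; apply/negbTE/negP => cu.
  by apply: no; exists u.
have l'N : size l' = n.+1.
  apply/eqP; rewrite eqn_leq -{1}Nn l'l /= leqNgt; apply/negP => l'n.
  by rewrite coef_big ?size_tuple in ct.
have tE : tval t = walls l' by apply: (coef_top _ _ _ ct); rewrite ?size_tuple.
have [a [l1 l'E]] : exists a l1, l' = a :: l1.
  by case: (l') l'N => // a l1; exists a, l1.
case/asboolP: Ct => r [r' rE].
have pE i : p ^+ i = b (f ^+ i).
  elim: i => [|i IH]; first by rewrite !expg0 hom1.
  by rewrite !expgS IH gmulfM.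
(* Each passage of a coset from the front to the end multiplies it by [p], whence the powers of
   [f]. *)
have [m [k [h1 /mapP[u ul ->]]]] : exists m k, exists2 h, h \in w &
    p ^+ m *! (b x *! (b a *! H)) = p ^+ k *! h.
  have : b x *! (b a *! H) \in [seq b x *! h | h <- t].
    by rewrite tE l'E walls_cons /= mem_head.
  move=> /(mem_iter_rot p r)[m]; rewrite rE => /mem_iter_rotV[h hw [k kE]].
  by exists m, k, h.
rewrite !pE -!lactM -!gmulfM => /lcoset_star_img[c sc xaE].
exists m, k, u, c; split => //; rewrite l'E /=.
have -> : x * a = f ^- m * (f ^+ m * x * a) by rewrite -!mulgA mulKg.
by rewrite gmulfM xaE -gmulfM !mulgA.
Qed.

(** Each side has a nonzero coefficient at its own top monomial and none in higher degree, so the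
    degrees agree, then the monomials; equal walls mean prefixes equal up to the star. *)
Lemma syllables_eq N l z l' z' e :
  (forall a, a \in l -> noS a) -> (forall a, a \in l' -> noS a) ->
  noS z -> noS z' -> noS e -> size l <= N -> size l' <= N ->
  (forall a, a \in behead l -> separated a) ->
  (forall a, a \in behead l' -> separated a) ->
  magnus_level N (cprod s l * z) = magnus_level N (e * (cprod s l' * z')) ->
  size l = size l' /\ forall i, i < size l -> exists2 c, parab star c &
    b (e * nth 1 (prefs s l') i) = b (nth 1 (prefs s l) i * c).
Proof.
move=> lS l'S zS z'S eS lN l'N lsep l'sep /magnus_levelP fg.
have sl := sorted_walls lsep; have sl' := sorted_walls l'sep.
have cl := coef_walls lS zS sl; have cl' := coef_walls l'S z'S sl'.
rewrite fg ?size_walls // coef_noSM // in cl.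
have ll' : size l <= size l'.
  rewrite leqNgt; apply/negP => lt; move: cl.
  by rewrite /shift coef_big // size_map size_walls.
have wE : [seq b e *! h | h <- walls l'] = walls l.
  have ce : coef (cprod s l * z) [seq b e *! h | h <- walls l'].
    rewrite fg ?size_map ?size_prefs // coef_noSM // /shift -map_comp.
    rewrite [map _ _](_ : _ = walls l') // -[RHS]map_id.
    by apply: eq_map => h /=; rewrite lactE.
  have l'l : size l' <= size l.
    rewrite leqNgt; apply/negP => lt; move: ce.
    by rewrite coef_big // size_map size_walls.
  by apply: (coef_top lS zS _ ce); rewrite size_map size_walls; apply/eqP; rewrite eqn_leq l'l.
have sE : size l = size l' by rewrite -(size_walls l) -wE size_map size_walls.
split=> // i il; have := congr1 (fun w => nth finset.set0 w i) wE.
rewrite (nth_map finset.set0) ?size_walls -?sE // /walls.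
rewrite !(nth_map 1) ?size_prefs -?sE // -lactM -gmulfM.
exact: lcoset_star_img.
Qed.
End Magnus.

(** * Intersections of translates of parabolic subgroups *)

Section Separation.
Variables (Gamma : simplicial_graph) (two : bool).
Local Notation V := {classic (vertex Gamma)}.
Local Notation G := (right_angled_coxeter_group Gamma).
Local Notation lev := (level Gamma two).
Local Notation noS s := (parab (fun v => v != s)).
Local Notation sup F := (parab (fun v => v \in F)).

Definition links (T : seq V) : pred V := fun v => all (fun t => adj t v) T.

(* The set of those x that satisfy the approximate condition N b x for all
   levels b is either excluded at some level or is the closure of a two-sided
   translate of a parabolic subgroup, all of whose elements satisfy E. *)
Definition described (F R : seq V) (D : pred V) (N : lev -> G -> Prop)
    (E : G -> Prop) : Prop :=
  (exists b, forall x, ~ N b x) \/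
  exists u w T, [/\ sup F u, sup F w, {subset T <= R},
    forall k, parab (fun v => D v && links T v) k -> E (u * k * w) &
    forall a : lev, exists b, forall x, N b x ->
      exists2 k, parab (fun v => D v && links T v) k & a x = a (u * k * w)].

(** The set in question is the intersection of G_I with a G_J b^-1. *)
Definition inter F : Prop := forall I J a b, sup F a -> sup F b ->
  described F F (fun v => I v && J v)
    (fun (c : lev) x => parab I x /\ exists2 y, parab J y & c (x * b) = c (a * y))
    (fun x => parab I x /\ parab J (a^-1 * x * b)).

Definition cent F : Prop := forall D f g, sup F f -> sup F g ->
  retr D f = 1 -> retr D g = 1 ->
  described F F D (fun (c : lev) e => parab D e /\ c (f * e) = c (e * g))
    (fun e => parab D e /\ f * e = e * g).

Lemma described_impl F R F2 R2 D (N N2 : lev -> G -> Prop) (E E2 : G -> Prop) :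
  {subset F <= F2} -> {subset R <= R2} ->
  (forall b1, exists b2, forall x, N2 b2 x -> N b1 x) ->
  (forall x, E x -> E2 x) -> described F R D N E -> described F2 R2 D N2 E2.
Proof.
move=> FF RR NN EE [[b bN]|[u [w [T [Fu Fw TR TE Ta]]]]].
  by left; have [b2 b2N] := NN b; exists b2 => x /b2N /bN.
right; exists u, w, T; split.
- exact: parab_sub Fu.
- exact: parab_sub Fw.
- by move=> t /TR /RR.
- by move=> k /TE /EE.
by move=> a; have [b bN] := Ta a; have [b2 b2N] := NN b; exists b2 => x /b2N /bN.
Qed.

Definition mono (N : lev -> G -> Prop) : Prop :=
  forall b1 b2 x, N (pair_level b1 b2) x -> N b1 x /\ N b2 x.

(* Applying the retractions onto G_J and G_I to x b = a y expresses x as p e q with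
   e = retr J x, and turns the equation into the conjugation equation f e = e g. *)
Lemma cent_inter F : cent F -> inter F.
Proof.
move=> centF I J a b Fa Fb.
pose a' := a * (retr J a)^-1; pose b' := b * (retr J b)^-1.
pose p := retr I a'; pose q := (retr I b')^-1.
have Fr W x : sup F x -> sup F (retr W x) by apply: parab_retr.
have Fa' : sup F a' by apply: parabM => //; apply/parabV/Fr.
have Fb' : sup F b' by apply: parabM => //; apply/parabV/Fr.
have Fp : sup F p by apply: Fr.
have Fq : sup F q by apply/parabV/Fr.
pose f := a'^-1 * p; pose g := b'^-1 * q^-1.
have rJ x : retr J (x * (retr J x)^-1) = 1.
  by rewrite gmulfM homV -[in X in _ * X]/(parab J (retr J x)) (retr_parab J x) mulgV.
pose D : pred V := fun v => I v && J v.
have rD x : retr J x = 1 -> retr D (x^-1 * retr I x) = 1.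
  have Dx y : retr D y = retr I (retr J y) by rewrite retrI.
  by move=> xJ; rewrite gmulfM homV !Dx xJ hom1 invg1 mul1g [retr J _]retrC xJ !hom1.
(* [c'] also records modulo [c] the images under [retr J], [retr I] and their composite, so that
   these retractions may be applied to an equation valid only modulo [c']. *)
have key (c : lev) : exists c' : lev, forall x y, parab I x -> parab J y ->
    c' (x * b) = c' (a * y) ->
    c (f * retr J x) = c (retr J x * g) /\ c x = c (p * retr J x * q).
  pose cJ := pull_level c J; pose cI := pull_level c I.
  exists (pair_level (pair_level c cJ) (pair_level cI (pull_level cI J))) => x y Ix Jy.
  rewrite !pair_levelE /= => -[[c1 c2] [c3 c4]]; set e := retr J x.
  have Ie : parab I e by apply: parab_retr.
  have aux (h : {multiplicative G -> lgrp c}) :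
      h (x * b) = h (a * y) -> h (retr J (x * b)) = h (retr J (a * y)) ->
      h (x * b') = h (a' * e).
    move=> h1; rewrite [retr J (a * y)]gmulfM Jy [retr J (x * b)]gmulfM => h2.
    have yE : h y = h ((retr J a)^-1 * (e * retr J b)) by rewrite gmulfM h2 -gmulfM mulKg.
    rewrite /b' mulgA [LHS]gmulfM h1 [h (a * y)]gmulfM yE -!(homM h); congr (h _).
    by rewrite /a' -!mulgA mulgV mulg1.
  have E1 := aux c c1 c2.
  have xE : c x = c (p * e * q).
    have E3 : c (retr I (x * b')) = c (retr I (a' * e)) := aux (c \o retr I) c3 c4.
    rewrite [retr I (x * b')]homM [retr I (a' * e)]homM Ix Ie in E3.
    by rewrite [RHS]homM -E3 -homM mulgK.
  split=> //; apply: (mulgI (c a')); rewrite -!gmulfM.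
  have -> : a' * (f * e) = p * e by rewrite !mulgA mulgV mul1g.
  have -> : a' * (e * g) = (a' * e) * g by rewrite mulgA.
  rewrite [RHS]homM -E1 [c (x * b')]homM xE -!(homM c); congr (c _).
  by rewrite /g; move: (b') => y'; rewrite !mulgA !mulgK.
case: (centF D f g) => [||||[c cN]|[u [w [T [Fu Fw TF TE Ta]]]]].
- by apply: parabM => //; apply: parabV.
- by apply: parabM; apply: parabV.
- exact/rD/rJ.
- by rewrite /g invgK; apply/rD/rJ.
- left; have [c' c'P] := key c; exists c' => x [Ix [y Jy /c'P[]// E _]].
  apply: (cN (retr J x)); split=> //.
  by apply: parabI; [apply: parab_retr | apply: retr_parab].
right; exists (p * u), (w * q), T; split=> //.
- exact: parabM.
- exact: parabM.
- move=> k /TE[De fe]; set e := u * k * w in De fe.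
  have -> : p * u * k * (w * q) = p * e * q by rewrite /e !mulgA.
  have Ie : parab I e by apply: parab_sub De => v /andP[].
  have Je : parab J e by apply: parab_sub De => v /andP[].
  split.
    by apply: parabM; [apply: parabM => //; apply: retr_parab | apply/parabV/retr_parab].
  have -> : a^-1 * (p * e * q) * b = (retr J a)^-1 * e * retr J b.
    have E1 : p * e * q * b' = a' * e.
      have -> : p * e = a' * (f * e) by rewrite !mulgA mulgV mul1g.
      by rewrite fe /g; move: (a') (b') (q) => x1 x2 x3; rewrite !mulgA !mulgVK.
    have E2 : p * e * q * b = a' * e * retr J b by rewrite -E1 /b' !mulgA mulgVK.
    by rewrite -[LHS]mulgA E2 /a' !mulgA mulVg mul1g.
  by apply: parabM; [apply: parabM => //; apply/parabV/retr_parab | apply: retr_parab].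
move=> al; have [c cN] := Ta (pair_level al al).
have [c' c'P] := key (pair_level c al); exists c' => x [Ix [y Jy /c'P[]//]].
rewrite !pair_levelE => -[E1 _] [_ E2].
have [|k Kk] := cN (retr J x).
  by split=> //; apply: parabI; [apply: parab_retr | apply: retr_parab].
rewrite pair_levelE => -[kE _]; exists k => //.
by rewrite E2 [LHS]homM [al (p * _)]homM kE -!(homM al) !mulgA.
Qed.
End Separation.

(** * Syllables with respect to a vertex *)

Section Decomposition.
Variable Gamma : simplicial_graph.
Local Notation V := {classic (vertex Gamma)}.
Local Notation G := (right_angled_coxeter_group Gamma).
Variable s : V.
Local Notation lk := (fun v => adj s v).
Local Notation noS := (parab (fun v => v != s)).
Local Notation ret := (retr (fun v => v != s)).

Lemma star_comm x : parab (star s) x -> gen s * x = x * gen s.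
Proof. exact: parab_comm. Qed.

Lemma lk_comm x : parab lk x -> gen s * x = x * gen s.
Proof. by apply: parab_comm => v ->. Qed.

Lemma parab_lk x : parab (star s) x -> parab lk (ret x).
Proof.
move=> sx; have := parabI (retr_parab (fun v => v != s) x) (parab_retr (fun v => v != s) sx).
by apply: parab_sub => v /andP[vs]; rewrite /star (negbTE vs) orbF.
Qed.

(** A syllable of the star between two letters [s] commutes with them and lets them cancel. No [s]
    precedes the first syllable, hence [behead]. *)
Lemma syll_decomp (U : pred V) f : parab U f -> exists l z,
  [/\ f = cprod s l * z, forall a, a \in z :: l -> parab (fun v => U v && (v != s)) a &
    forall a, a \in behead l -> ~ parab (star s) a].
Proof.
set U' : pred V := fun v => U v && (v != s).
move: f; apply: parab_ind => [|v f Uv _ [l [z [-> lU ls]]]].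
  by exists [::], 1; rewrite mulg1; split=> // a; rewrite inE => /eqP->; apply: parab1.
have zU : parab U' z by apply/lU/mem_head.
have lU' a : a \in l -> parab U' a by move=> al; apply: lU; rewrite inE al orbT.
have mul_head x l1 : parab U' x -> (forall a, a \in l1 -> parab U' a) ->
    (forall a, a \in behead l1 -> ~ parab (star s) a) -> exists l z0,
    [/\ x * (cprod s l1 * z) = cprod s l * z0, forall a, a \in z0 :: l -> parab U' a &
    forall a, a \in behead l -> ~ parab (star s) a].
  move=> Ux l1U l1s; case: l1 l1U l1s => [|a l1] l1U l1s.
    exists [::], (x * z); rewrite /= !mul1g; split=> // c.
    by rewrite inE => /eqP->; apply: parabM.
  exists (x * a :: l1), z; rewrite /= -!mulgA; split=> // c.
  rewrite inE => /predU1P[->//|]; rewrite inE => /predU1P[->|cl].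
    by apply/parabM/l1U => //; apply: mem_head.
  by apply: l1U; rewrite inE cl orbT.
have [vs|vs] := eqVneq v s; last first.
  by apply: mul_head => //; apply: parab_gen; rewrite /U' Uv vs.
case: l lU' ls {lU} => [|a l] lU ls.
  exists [:: 1], z; rewrite /= vs !mul1g mulg1; split=> // c.
  by rewrite !inE => /orP[] /eqP-> //; apply: parab1.
have aU : parab U' a by apply/lU/mem_head.
have lU1 c : c \in l -> parab U' c by move=> cl; apply: lU; rewrite inE cl orbT.
have [sa|sa] := pselect (parab (star s) a); last first.
  exists [:: 1, a & l], z; split=> [|c|c].
  - by rewrite /= vs !mul1g !mulgA.
  - rewrite inE => /predU1P[->//|]; rewrite inE => /predU1P[->|/lU//].
    exact: parab1.
  - by rewrite /= inE => /predU1P[->//|cl]; apply: ls.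
rewrite vs cprod_consM mulgA (star_comm sa) -mulgA genK.
by apply: mul_head => // c /mem_behead cl; apply: ls.
Qed.

(** An equation that holds after deleting the letters [s] lifts back: each discrepancy [c] between
    prefixes lies in the link, commutes with [s] and is carried past one letter at a time. *)
Lemma exact_syllables l z l' z' x y : size l = size l' ->
  (forall a, a \in z :: l -> noS a) -> (forall a, a \in z' :: l' -> noS a) ->
  (forall i, i < size l -> exists2 c, parab lk c &
    x * ret (nth 1 (prefs s l') i) = ret (nth 1 (prefs s l) i) * c) ->
  ret (cprod s l * z) * y = x * ret (cprod s l' * z') ->
  cprod s l * z * y = x * (cprod s l' * z').
Proof.
elim: l l' x => [|a l IH] [|a' l'] x // => [_ lS l'S _|[sE] lS l'S xE].
  have zS : noS z by apply/lS/mem_head.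
  have z'S : noS z' by apply/l'S/mem_head.
  by rewrite /= !mul1g zS z'S.
have aS : noS a by apply: lS; rewrite !inE eqxx orbT.
have a'S : noS a' by apply: l'S; rewrite !inE eqxx orbT.
have retM u g : noS u -> ret (u * (gen s * g)) = u * ret g.
  by move=> uS; rewrite !homM uS retr_gen eqxx mul1g.
have [c lkc /=] := xE 0 isT; rewrite aS a'S => xc.
rewrite !cprod_consM !retM // [x * _]mulgA xc -!mulgA => /mulgI yE.
have -> : x * (a' * (gen s * (cprod s l' * z'))) = a * (gen s * (c * (cprod s l' * z'))).
  by rewrite mulgA xc -mulgA; congr (_ * _); rewrite !mulgA (lk_comm lkc).
congr (_ * (_ * _)); rewrite mulgA; apply: IH => //.
- by move=> u; rewrite inE => /predU1P[->|ul]; apply: lS; rewrite !inE ?eqxx ?ul ?orbT.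
- by move=> u; rewrite inE => /predU1P[->|ul]; apply: l'S; rewrite !inE ?eqxx ?ul ?orbT.
move=> i il; have [d lkd] := xE i.+1 il.
rewrite /= !(nth_map 1) ?size_prefs -?sE // !retM // mulgA xc -!mulgA => /mulgI dE.
by exists d.
Qed.
End Decomposition.

(** * Successive intersections and separation from the star *)

Section Intersections.
Variables (Gamma : simplicial_graph) (two : bool).
Local Notation V := {classic (vertex Gamma)}.
Local Notation G := (right_angled_coxeter_group Gamma).
Local Notation lev := (level Gamma two).
Local Notation sup F := (parab (fun v => v \in F)).
Implicit Types (N : lev -> G -> Prop) (E : G -> Prop).

(** [N1] confines x to a translate up to a level; [N2] depends on x only modulo its level, so it can
    then be studied on that translate. *)
Lemma described_and F R D N1 E1 N2 E2 :
  mono N1 -> mono N2 -> (forall (b : lev) x y, b x = b y -> N2 b x -> N2 b y) ->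
  described F R D N1 E1 ->
  (forall u w T, sup F u -> sup F w -> {subset T <= R} ->
     let t x := exists2 k, parab (fun v => D v && links T v) k & x = u * k * w in
     described F R D (fun b x => t x /\ N2 b x) (fun x => t x /\ E2 x)) ->
  described F R D (fun b x => N1 b x /\ N2 b x) (fun x => E1 x /\ E2 x).
Proof.
move=> N1m N2m N2s [[b bN]|[u [w [T [Fu Fw TR TE Ta]]]]] H2.
  by left; exists b => x [/bN].
have tN k : parab (fun v => D v && links T v) k ->
  exists2 k0, parab (fun v => D v && links T v) k0 & u * k * w = u * k0 * w by exists k.
case: (H2 _ _ _ Fu Fw TR) => [[b2 b2N]|[u' [w' [T' [Fu' Fw' TR' TE' Ta']]]]].
  left; have [b1 b1N] := Ta b2; exists (pair_level b1 b2) => x [/N1m[N1x _] /N2m[_ N2x]].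
  have [k Kk kE] := b1N _ N1x.
  by apply: (b2N (u * k * w)); split; [apply: tN | apply: N2s N2x].
right; exists u', w', T'; split=> //.
  by move=> k /TE' [[k0 /TE E1k ->] E2k].
move=> a; have [b2 b2N] := Ta' a; have [b1 b1N] := Ta (pair_level b2 a).
exists (pair_level b1 b2) => x [/N1m[N1x _] /N2m[_ N2x]].
have [k Kk /pair_levelE[kE2 kEa]] := b1N _ N1x.
have [|k' Kk' k'E] := b2N (u * k * w).
  by split; [apply: tN | apply: N2s N2x].
by exists k' => //; rewrite kEa.
Qed.

(** Writing x = u k w turns x = p c q into k w q^-1 = u^-1 p c, an instance of [inter] with unknown
    k. *)
Lemma described_translate F R (D B : pred V) T (TB : seq V) u w p q :
  inter two F -> {subset F <= R} -> sup F u -> sup F w -> sup F p -> sup F q ->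
  {subset T <= R} -> {subset TB <= R} -> B =1 links TB ->
  let t x := exists2 k, parab (fun v => D v && links T v) k & x = u * k * w in
  described F R D
    (fun (b : lev) x => t x /\ exists2 c, parab B c & b x = b (p * c * q))
    (fun x => t x /\ exists2 c, parab B c & x = p * c * q).
Proof.
move=> interF FR Fu Fw Fp Fq TR TBR BT t.
have := interF (fun v => D v && links T v) B (u^-1 * p) (w * q^-1).
case=> [||[b bN]|[u' [w' [T' [Fu' Fw' TF' TE' Ta']]]]].
- by apply: parabM => //; apply: parabV.
- by apply: parabM => //; apply: parabV.
- left; exists b => x [[k Kk xE] [c Bc bx]].
  apply: (bN k); split=> //; exists c => //.
  have -> : k * (w * q^-1) = u^-1 * x * q^-1 by rewrite xE -!mulgA mulKg.
  have -> : u^-1 * p * c = u^-1 * (p * c * q) * q^-1 by rewrite !mulgA mulgK.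
  by rewrite !homM bx !homM.
have KE : (fun v => D v && links (T ++ TB ++ T') v)
    = (fun v => (fun v => D v && links T v && B v) v && links T' v).
  by apply: funext => v; rewrite BT /links !all_cat !andbA.
right; exists (u * u'), (w' * w), (T ++ TB ++ T'); rewrite KE; split.
- exact: parabM.
- exact: parabM.
- by move=> v; rewrite !mem_cat => /or3P[/TR|/TBR|/TF' /FR].
- move=> k /TE'[Kk Bk]; split.
    by exists (u' * k * w') => //; rewrite !mulgA.
  exists ((u^-1 * p)^-1 * (u' * k * w') * (w * q^-1)) => //.
  by rewrite invgM invgK !mulgA mulgV mul1g mulgVK.
move=> a; have [b bN] := Ta' a; exists b => x [[k Kk xE] [c Bc bx]].
have [|k' Kk' k'E] := bN k.
  split=> //; exists c => //.
  have -> : k * (w * q^-1) = u^-1 * x * q^-1 by rewrite xE -!mulgA mulKg.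
  have -> : u^-1 * p * c = u^-1 * (p * c * q) * q^-1 by rewrite !mulgA mulgK.
  by rewrite !homM bx !homM.
exists k' => //; have -> : u * u' * k' * (w' * w) = u * (u' * k' * w') * w by rewrite !mulgA.
by rewrite xE homM [a (u * k)]homM k'E -!(homM a).
Qed.

Lemma described_translates F R (D B : pred V) (TB : seq V) (C : seq (G * G)) N E :
  inter two F -> {subset F <= R} -> {subset TB <= R} -> B =1 links TB ->
  (forall pq, pq \in C -> sup F pq.1 /\ sup F pq.2) -> mono N ->
  described F R D N E ->
  described F R D
    (fun b x => N b x /\ forall pq, pq \in C ->
       exists2 c, parab B c & b x = b (pq.1 * c * pq.2))
    (fun x => E x /\ forall pq, pq \in C -> exists2 c, parab B c & x = pq.1 * c * pq.2).
Proof.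
move=> interF FR TBR BT CF Nm dN; elim: C CF => [|[p q] C IH] CF.
  by apply: described_impl dN => // b; exists b => x [].
have [Fp Fq] := CF (p, q) (mem_head _ _).
have {}IH := IH (fun pq pqC => CF pq (mem_behead (s := _ :: C) pqC)).
set N1 := (fun b x => _) in IH; set E1 := (fun x => _) in IH.
have N1m : mono N1.
  move=> b1 b2 x [/Nm[N1x N2x] Cx]; split; split=> // pq /Cx[c Bc];
  by rewrite pair_levelE => -[]; exists c.
pose N2 (b : lev) x := exists2 c, parab B c & b x = b (p * c * q).
have N2m : mono N2.
  by move=> b1 b2 x [c Bc]; rewrite pair_levelE => -[]; split; exists c.
have N2s (b : lev) x y : b x = b y -> N2 b x -> N2 b y.
  by move=> xy [c Bc E2]; exists c => //; rewrite -xy.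
have := described_and N1m N2m N2s IH (fun u w T Fu Fw TR =>
  described_translate D interF FR Fu Fw Fp Fq TR TBR BT).
apply: described_impl => // [b|x [[Ex Cx] E2x]].
  exists b => x [Nx Cx]; split; last by apply: (Cx (p, q)); apply: mem_head.
  by split=> // pq pqC; apply: Cx; rewrite inE pqC orbT.
by split=> // pq; rewrite inE => /predU1P[->//|/Cx].
Qed.

(** In [inter] with G_I trivial the only candidate is x = 1, and a nonempty intersection would put
    [a] in the star; hence some level excludes it. *)
Lemma exists_separated F s a : inter two F -> sup F a -> ~ parab (star s) a ->
  exists b : lev, separated b s a.
Proof.
move=> interF Fa sa.
case: (interF (fun=> false) (star s) a 1) => [//||[b bN]|[u [w [T [_ _ _ TE _]]]]].
- exact: parab1.
- exists b => z sz az; apply: (bN 1); split; first exact: parab1.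
  exists z^-1; first exact: parabV.
  by rewrite mulg1 !homM homV az mulgV hom1.
case: sa; have [|/parab0 -> ] := TE 1; first exact: parab1.
by rewrite !mulg1 => /parabV; rewrite invgK.
Qed.

Lemma exists_separated_all F s (l : seq G) : inter two F ->
  (forall a, a \in l -> sup F a /\ ~ parab (star s) a) ->
  forall b0 : lev, exists b : lev, (forall x y, b x = b y -> b0 x = b0 y) /\
    forall a, a \in l -> separated b s a.
Proof.
move=> interF; elim: l => [|a l IH] lF b0; first by exists b0.
have [|b [bb0 bl]] := IH _ b0.
  by move=> c cl; apply: lF; rewrite inE cl orbT.
have [Fa sa] := lF a (mem_head _ _).
have [b1 b1a] := exists_separated interF Fa sa.
exists (pair_level b b1); split=> [x y|c]; first by rewrite pair_levelE => -[/bb0].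
rewrite inE => /predU1P[->|/bl bc] z sz; rewrite pair_levelE => -[e1 e2].
  exact: b1a sz e2.
exact: bc sz e1.
Qed.
End Intersections.

(** * Conjugation equations with trivial retractions *)

Section CentralizerStep.
Variables (Gamma : simplicial_graph) (two : bool).
Local Notation V := {classic (vertex Gamma)}.
Local Notation G := (right_angled_coxeter_group Gamma).
Local Notation lev := (level Gamma two).
Local Notation sup F := (parab (fun v => v \in F)).

(** A vertex [s] of [F] outside [D] does not occur in the unknown e, so the s-syllables of f e and e
    g can be compared: each prefix puts e in a translate of G_{lk s}, and there remains the equation
    with [s] deleted, over fewer vertices. *)
Lemma cent_step (F : seq V) :
  (forall F', size F' < size F -> @inter Gamma two F' /\ @cent Gamma two F') -> @cent Gamma two F.
Proof.
move=> IH D f g Ff Fg Df Dg.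
have [FD|/existsNP[s /not_implyP[sF sD]]] := pselect (forall t, t \in F -> D t).
  have f1 : f = 1 by rewrite -Df; apply/esym/(parab_sub FD).
  have g1 : g = 1 by rewrite -Dg; apply/esym/(parab_sub FD).
  right; exists 1, 1, [::]; split=> //; try exact: parab1.
    move=> k Dk; rewrite !mul1g mulg1 f1 g1 mul1g mulg1; split=> //.
    by apply: parab_sub Dk => v /andP[].
  move=> a; exists a => x [Dx _]; exists x; last by rewrite mul1g mulg1.
  by apply: parab_sub Dx => v ->.
pose F' := [seq t <- F | t != s].
have F'F : {subset F' <= F} by move=> t; rewrite mem_filter => /andP[].
have szF' : size F' < size F.
  rewrite size_filter -(count_predC (fun t => t != s)) -[X in X < _]addn0 ltn_add2l.
  by rewrite -has_count; apply/hasP; exists s => //=; rewrite eqxx.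
have [interF' centF'] := IH F' szF'.
have supF' x : parab (fun v => (v \in F) && (v != s)) x -> sup F' x.
  by apply: parab_sub => v; rewrite mem_filter andbC.
pose A : pred V := fun v => v != s.
have [l [z [fE lF lsep]]] := syll_decomp s Ff.
have [l' [z' [gE l'F l'sep]]] := syll_decomp s Fg.
have subA x : parab (fun v => (v \in F) && (v != s)) x -> parab A x.
  by apply: parab_sub => v /andP[].
have DA x : parab D x -> parab A x.
  by apply: parab_sub => v Dv; apply/eqP => vs; apply: sD; rewrite -vs.
have lA a : a \in z :: l -> parab A a by move=> /lF /subA.
have l'A a : a \in z' :: l' -> parab A a by move=> /l'F /subA.
have lA1 a : a \in l -> parab A a by move=> al; apply: lA; rewrite inE al orbT.
have l'A1 a : a \in l' -> parab A a by move=> al; apply: l'A; rewrite inE al orbT.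
have zA : parab A z by apply/lA/mem_head.
have z'A : parab A z' by apply/l'A/mem_head.
pose N := maxn (size l) (size l').
have sepP a : a \in behead l ++ behead l' -> sup F' a /\ ~ parab (star s) a.
  rewrite mem_cat => /orP[] al; split; try exact: lsep; try exact: l'sep.
    by apply/supF'/lF; rewrite inE mem_behead ?orbT.
  by apply/supF'/l'F; rewrite inE mem_behead ?orbT.
(* The Magnus level is built over a quotient that keeps the inner syllables out of the star, so that
   top coefficients are nonzero. *)
have level_for (b0 : lev) : exists b : lev, forall e, parab D e -> b (f * e) = b (e * g) ->
    size l = size l' /\ forall i, i < size l -> exists2 c, parab (star s) c &
      b0 (e * nth 1 (prefs s l') i) = b0 (nth 1 (prefs s l) i * c).
  have [b1 [b01 b1sep]] := exists_separated_all interF' sepP b0.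
  exists (magnus_level b1 s N) => e De; rewrite fE gE -mulgA => fe.
  have [||sE iE] := syllables_eq lA1 l'A1 (parabM zA (DA _ De)) z'A (DA _ De)
    (leq_maxl _ _) (leq_maxr _ _) _ _ fe.
  - by move=> a al; apply: b1sep; rewrite mem_cat al.
  - by move=> a al; apply: b1sep; rewrite mem_cat al orbT.
  by split=> // i /iE[c sc /b01]; exists c.
have [sE|sE] := eqVneq (size l) (size l'); last first.
  left; have [b bP] := level_for (trivial_level Gamma two); exists b => x [Dx /bP[]//].
  by move/eqP; rewrite (negbTE sE).
(* From e u' = u c for corresponding prefixes one gets e = u c u'^-1, here with [s] deleted. *)
pose C := zip [seq retr A u | u <- prefs s l] [seq (retr A u)^-1 | u <- prefs s l'].
have nthC i : i < size l -> nth (1, 1) C i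
    = (retr A (nth 1 (prefs s l) i), (retr A (nth 1 (prefs s l') i))^-1).
  move=> il; rewrite nth_zip ?size_map ?size_prefs // !(nth_map 1) ?size_prefs //.
  by rewrite -sE.
have sizeC : size C = size l by rewrite size_zip !size_map !size_prefs -sE minnn.
have supret x : sup F x -> sup F' (retr A x).
  by move=> Fx; apply: supF'; apply: parabI; [apply: parab_retr | apply: retr_parab].
have prefF l0 z0 : (forall a, a \in z0 :: l0 -> parab (fun v => (v \in F) && (v != s)) a) ->
    forall i, sup F (nth 1 (prefs s l0) i).
  move=> l0F i; have [il|il] := ltnP i (size l0); last first.
    by rewrite nth_default ?size_prefs //; apply: parab1.
  apply: (@parab_prefs _ s _ l0); [exact: parab_gen | | by rewrite mem_nth ?size_prefs].
  by move=> a al; apply: parab_sub (l0F a _) => [v /andP[]//|]; rewrite inE al orbT.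
have CF pq : pq \in C -> sup F' pq.1 /\ sup F' pq.2.
  case/(nthP (1, 1)) => i; rewrite sizeC => il <-; rewrite nthC //=.
  by split; [apply/supret/prefF/lF | apply/parabV/supret/prefF/l'F].
have sR : {subset [:: s] <= F} by move=> v; rewrite inE => /eqP->.
have lkE : (fun v => adj s v) =1 links [:: s] by move=> v; rewrite /links /= andbT.
have N1m : mono (fun (b : lev) e => parab D e /\ b (retr A f * e) = b (e * retr A g)).
  by move=> b1 b2 e [De]; rewrite pair_levelE => -[].
have Dret x : retr D x = 1 -> retr D (retr A x) = 1 by rewrite retrC => ->; apply: hom1.
have cd := centF' D _ _ (supret _ Ff) (supret _ Fg) (Dret _ Df) (Dret _ Dg).
have cd' := described_impl (fun v => id) F'F (fun b => ex_intro _ b (fun x => id))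
  (fun x => id) cd.
have := described_translates interF' F'F sR lkE CF N1m cd'.
apply: described_impl => // [b|e [[De fe] Ce]].
  have [b2 b2P] := level_for (pull_level b A).
  exists (pair_level (pull_level b A) b2) => e [De]; rewrite pair_levelE => -[e1 e2].
  split.
    split=> //; move: e1; rewrite /= !(homM (retr A)) (DA _ De) //.
  move=> pq /(nthP (1, 1)) [i]; rewrite sizeC => il <-; rewrite nthC //=.
  have [_ /(_ i il)[c sc]] := b2P e De e2.
  rewrite /= !(homM (retr A)) (DA _ De) => ec; exists (retr A c); first exact: parab_lk.
  by rewrite homM -ec -homM mulgK.
split=> //; rewrite fE gE; apply: exact_syllables => //; last by rewrite -fE -gE.
move=> i il; have := Ce (nth (1, 1) C i); rewrite mem_nth ?sizeC // nthC //= => -[//|c Bc eE].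
by exists c => //; rewrite eE mulgVK.
Qed.

Lemma cent_inter_all (F : seq V) : @inter Gamma two F /\ @cent Gamma two F.
Proof.
have [n] := ubnP (size F); elim: n F => // n IH F Fn.
have cF : @cent Gamma two F.
  apply: cent_step => F' F'F; apply: IH; exact: leq_trans F'F _.
by split=> //; apply: cent_inter.
Qed.
End CentralizerStep.

(** * Conjugacy *)

Section CyclicForm.
Variable Gamma : simplicial_graph.
Local Notation V := {classic (vertex Gamma)}.
Local Notation G := (right_angled_coxeter_group Gamma).

Lemma parabJ (U : pred V) x y : parab U x -> parab U y -> parab U (x ^ y).
Proof. by move=> Ux Uy; apply: parabM; [apply: parabV | apply: parabM]. Qed.

Lemma conjVE (x y : G) : x ^ y^-1 = y * x * y^-1.
Proof. by rewrite conjgE invgK mulgA. Qed.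

(** Descent on the number of letters [s], read cyclically: two of them enclosing a syllable of the
    star cancel. A lone [s] has no partner, hence the proviso [1 < size l]. *)
Lemma cyclic_form (U : pred V) s f : U s -> parab U f -> exists h l z,
  [/\ parab U h, f ^ h = cprod s l * z,
    forall a, a \in z :: l -> parab (fun v => U v && (v != s)) a &
    l = [::] \/ z = 1 /\ (1 < size l -> forall a, a \in l -> ~ parab (star s) a)].
Proof.
move=> Us Uf; set U' : pred V := fun v => U v && (v != s).
have U'U x : parab U' x -> parab U x by apply: parab_sub => v /andP[].
have sU : parab U (gen s) by apply: parab_gen.
have [l0 [z0 [-> l0U _]]] := syll_decomp s Uf; move: l0U.
have [n] := ubnP (size l0); elim: n l0 z0 => // n IH [|a l] z ln lU.
  by exists 1, [::], z; rewrite conjg1; split=> //; [apply: parab1 | left].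
have zU : parab U' z by apply/lU/mem_head.
pose l2 := z * a :: l.
have l2U c : c \in l2 -> parab U' c.
  rewrite inE => /predU1P[->|cl]; last by apply: lU; rewrite !inE cl !orbT.
  by apply: parabM => //; apply: lU; rewrite !inE eqxx orbT.
have E2 : (cprod s (a :: l) * z) ^ z^-1 = cprod s l2 * 1.
  by rewrite conjVE mulgA mulgK mulg1 /= !mulgA.
have memE c : c \in l2 -> exists la lb, l2 = la ++ c :: lb.
  by case/splitPr => la lb; exists la, lb.
have [[size2 [c cl2 sc]]|no] := pselect (1 < size l2 /\ exists2 c, c \in l2 & parab (star s) c);
    last first.
  exists z^-1, l2, 1; split=> //; first exact/parabV/U'U.
    by move=> c; rewrite inE => /predU1P[->|/l2U//]; apply: parab1.
  by right; split=> // l2n c cl sc; apply: no; split=> //; exists c.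
have cU := l2U _ cl2; have [la [lb l2E]] := memE c cl2.
have [r0 [d rE]] : exists r0 d, lb ++ la = rcons r0 d.
  case/lastP: (lb ++ la) (size_cat lb la) => [|r0 d _]; last by exists r0, d.
  by move/esym/eqP; rewrite addn_eq0 => /andP[/nilP lb0 /nilP la0]; rewrite l2E lb0 la0 in size2.
have rU x : x \in rcons r0 d -> parab U' x.
  rewrite -rE mem_cat => xr; apply: l2U; rewrite l2E mem_cat inE.
  by case/orP: xr => ->; rewrite ?orbT.
have dU : parab U' d by apply: rU; rewrite mem_rcons mem_head.
have r0U x : x \in r0 -> parab U' x by move=> xr; apply: rU; rewrite mem_rcons inE xr orbT.
have laU : parab U (cprod s la).
  by apply: parab_cprod => // x xl; apply/U'U/l2U; rewrite l2E mem_cat xl.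
have size_r0 : (size r0).+2 = size l2.
  have := congr1 size rE; rewrite l2E !size_cat size_rcons /= => <-.
  by rewrite addnS addnC.
have r0n : size r0 < n by have [->] := size_r0; apply: ltnW; apply: ln.
(* Rotating [c] to the front and conjugating by [s] removes two letters [s]. *)
have E3 : (cprod s (a :: l) * z) ^ (z^-1 * cprod s la * gen s) = c * cprod s r0 * d.
  rewrite !conjgM E2 mulg1 l2E cprod_cat -conjgM conjgE invgM genV.
  rewrite -!mulgA mulKg [_ * (cprod s la * _)]mulgA -cprod_cat /= rE.
  rewrite -cats1 cprod_cat /= mulg1 mulgA -!mulgA [gen s * (c * _)]mulgA (star_comm sc).
  by rewrite !mulgA -(mulgA _ (gen s)) gen_sq mulg1 -(mulgA c) gen_sq mulg1.
have [l1 [z1 [l1E l1U l1n]]] : exists l1 z1, [/\ c * cprod s r0 * d = cprod s l1 * z1,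
    forall x, x \in z1 :: l1 -> parab U' x & size l1 = size r0].
  case: (r0) r0U => [|e r1] r0U.
    exists [::], (c * d); rewrite /= mulg1 mul1g; split=> // x.
    by rewrite inE => /eqP->; apply: parabM.
  exists (c * e :: r1), d; rewrite /= !mulgA; split=> // x.
  rewrite inE => /predU1P[->//|]; rewrite inE => /predU1P[->|xr].
    by apply/parabM/r0U => //; apply: mem_head.
  by apply: r0U; rewrite inE xr orbT.
have [|h [l3 [z3 [Uh hE l3U l3s]]]] := IH l1 z1 _ l1U; first by rewrite l1n.
exists (z^-1 * cprod s la * gen s * h), l3, z3; split=> //.
  by apply: parabM => //; apply: parabM => //; apply: parabM => //; apply/parabV/U'U.
by rewrite conjgM E3 l1E.
Qed.

Lemma star_split (D : pred V) s x : parab (fun v => D v && star s v) x ->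
  exists2 y, parab (fun v => D v && adj s v) y & x = y \/ x = y * gen s.
Proof.
move: x; apply: parab_ind => [|v x /andP[Dv sv] _ [y Ly xE]].
  by exists 1; [apply: parab1 | left].
have [vs|vs] := eqVneq v s.
  have sy : gen s * y = y * gen s by apply: lk_comm; apply: parab_sub Ly => u /andP[].
  exists y => //; case: xE => ->; rewrite vs; first by right.
  by left; rewrite mulgA sy -mulgA gen_sq mulg1.
exists (gen v * y); last by case: xE => ->; [left | right; rewrite mulgA].
apply: parabM Ly; apply: parab_gen; rewrite Dv /=.
by move: sv; rewrite /star (negbTE vs) orbF.
Qed.

Lemma conj_all_trivial (F : seq V) (U : pred V) f :
  (forall v, U v -> v \in F) -> parab U f ->
  (forall s, s \in F -> U s ->
     exists2 h, parab U h & parab (fun v => U v && (v != s)) (f ^ h)) -> f = 1.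
Proof.
move=> UF Uf Hs.
have [h Uh fh] : exists2 h, parab U h & parab (fun v => U v && (v \notin F)) (f ^ h).
  have : {subset F <= F} by [].
  elim: {-2}F => [|s F1 IH] F1F.
    by exists 1; [apply: parab1 | rewrite conjg1; apply: parab_sub Uf => v ->].
  have [|h Uh fh] := IH; first by move=> v vF; apply: F1F; rewrite inE vF orbT.
  have [Us|Us] := boolP (U s); last first.
    exists h => //; apply: parab_sub fh => v /andP[Uv vF]; rewrite Uv inE negb_or vF.
    by rewrite andbT; apply: contraNneq Us => <-.
  have [k Uk fk] := Hs s (F1F s (mem_head _ _)) Us.
  pose W : pred V := fun v => U v && (v \notin F1).
  (* [k] removes [s] but may bring back vertices removed earlier; applying [retr W] to the
     conjugation from [f ^ h] to [f ^ k] prevents this. *)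
  exists (h * retr W (h^-1 * k)).
    by apply: parabM => //; apply/parab_retr/parabM => //; apply: parabV.
  have -> : f ^ (h * retr W (h^-1 * k)) = retr W (f ^ k).
    have -> : f ^ k = (f ^ h) ^ (h^-1 * k) by rewrite -conjgM mulKVg.
    have hJ x y : retr W (x ^ y) = retr W x ^ retr W y.
      by rewrite !conjgE !homM homV.
    by rewrite hJ [retr W (f ^ h)]fh conjgM.
  apply: parab_sub (parabI (retr_parab W _) (parab_retr W fk)) => v.
  by rewrite /W inE negb_or => /andP[/andP[-> ->] /andP[_ ->]].
have fh1 : f ^ h = 1.
  apply: parab0; apply: parab_sub fh => v /andP[/UF vF].
  by rewrite vF.
by rewrite -(conjgK h f) fh1 conj1g.
Qed.
End CyclicForm.

(** * Approximating conjugators by exact ones *)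

Section Conjugacy.
Variables (Gamma : simplicial_graph) (two : bool).
Local Notation V := {classic (vertex Gamma)}.
Local Notation G := (right_angled_coxeter_group Gamma).
Local Notation lev := (level Gamma two).
Local Notation sup F := (parab (fun v => v \in F)).

Definition conj_sep (D : pred V) (f g : G) : Prop :=
  forall a : lev, exists b : lev, forall x, parab D x -> b (f * x) = b (x * g) ->
  exists y, [/\ parab D y, f * y = y * g & a y = a x].

Lemma conj_sep_sym D f g : conj_sep D g f -> conj_sep D f g.
Proof.
move=> fg a; have [b bP] := fg a; exists b => x Dx fx.
case: (bP x^-1) => [||y [Dy gy ay]]; first exact: parabV.
  have -> : g * x^-1 = x^-1 * (x * g) * x^-1 by rewrite mulKg.
  by rewrite !homM -homM -fx !homM -!mulgA -[b x * _]homM mulgV hom1 mulg1.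
exists y^-1; split; first exact: parabV; last by rewrite homV ay homV invgK.
by apply: (mulgI y); rewrite mulVKg mulgA -gy mulgK.
Qed.

Lemma conj_sep_conj D f g h k : parab D h -> parab D k ->
  conj_sep D (f ^ h) (g ^ k) -> conj_sep D f g.
Proof.
move=> Dh Dk fg a; have [b bP] := fg a; exists b => x Dx fx.
case: (bP (h^-1 * x * k)) => [||y [Dy fy ay]].
- by apply: parabM => //; apply: parabM => //; apply: parabV.
- have -> : f ^ h * (h^-1 * x * k) = h^-1 * (f * x) * k by rewrite conjgE !mulgA mulgK.
  have -> : h^-1 * x * k * g ^ k = h^-1 * (x * g) * k by rewrite conjgE !mulgA mulgK.
  by rewrite !homM -[b f * b x]homM fx homM.
exists (h * y * k^-1); split.
- by apply: parabM; [apply: parabM | apply: parabV].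
- have -> : f * (h * y * k^-1) = h * (f ^ h * y) * k^-1.
    by rewrite conjgE !mulgA mulgV mul1g.
  by rewrite fy conjgE -!mulgA mulgV mulg1.
rewrite homM [a (h * y)]homM ay -!homM; congr (a _).
by rewrite -!mulgA mulVKg mulgV mulg1.
Qed.

Lemma conj_sep_list D (L : seq (G * G)) :
  (forall p, p \in L -> conj_sep D p.1 p.2) ->
  forall a : lev, exists b : lev, forall p, p \in L ->
    forall x, parab D x -> b (p.1 * x) = b (x * p.2) ->
    exists y, [/\ parab D y, p.1 * y = y * p.2 & a y = a x].
Proof.
elim: L => [|p L IH] LP a; first by exists a.
have [q|b bP] := IH _ a; first by move=> qL; apply: LP; rewrite inE qL orbT.
have [b2 b2P] := LP p (mem_head _ _) a; exists (pair_level b b2) => q.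
rewrite inE => /predU1P[->|/bP {}bP] x Dx; rewrite pair_levelE => -[e1 e2].
  exact: b2P.
exact: bP.
Qed.

(** By [cyc_conjugate], x b1 = Z u c modulo a level, with Z a product of powers of f, u a prefix and
    c in the star. Splitting c as c0 e with e in {1, s} leaves f^u c0 = c0 g^(b1 e), whose unknown
    c0 lies over [D] and the link of [s]. *)
Lemma conj_core (F : seq V) (D : pred V) s l l' z' :
  s \in F -> D s ->
  let U v := (v \in F) && D v && (v != s) in
  (forall a, a \in l -> parab U a) -> (forall a, a \in z' :: l' -> parab U a) ->
  0 < size l -> size l' <= size l ->
  (1 < size l -> forall a, a \in l -> ~ parab (star s) a) ->
  (forall f g, sup F f -> sup F g -> conj_sep (fun v => D v && adj s v) f g) ->
  conj_sep D (cprod s l) (cprod s l' * z').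
Proof.
move=> sF sD U lU l'U l0 l'l ls IH.
set f := cprod s l; set g := cprod s l' * z'.
have UF x : parab U x -> sup F x by apply: parab_sub => v /andP[/andP[]].
have UD x : parab U x -> parab D x by apply: parab_sub => v /andP[/andP[]].
have US x : parab U x -> parab (fun v => v != s) x by apply: parab_sub => v /andP[].
have l'U1 a : a \in l' -> parab U a by move=> al; apply: l'U; rewrite inE al orbT.
have z'U : parab U z' by apply/l'U/mem_head.
have sFp : sup F (gen s) by apply: parab_gen.
have sDp : parab D (gen s) by apply: parab_gen.
have Ff : sup F f by apply: parab_cprod => // a /lU /UF.
have Df : parab D f by apply: parab_cprod => // a /lU /UD.
have Fg : sup F g by apply: parabM; [apply: parab_cprod => // a /l'U1 /UF | apply: UF].
have Dg : parab D g by apply: parabM; [apply: parab_cprod => // a /l'U1 /UD | apply: UD].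
set b1 := head 1 l'.
have Ub1 : parab U b1.
  by rewrite /b1; case: (l') l'U1 => [|a l1] H; [apply: parab1 | apply/H/mem_head].
have Fprefs u : u \in prefs s l -> sup F u by apply: parab_prefs => // a /lU /UF.
have Dprefs u : u \in prefs s l -> parab D u by apply: parab_prefs => // a /lU /UD.
(* There are finitely many such equations, so a single level [b0] serves them all. *)
pose L := [seq (f ^ u, g ^ b1) | u <- prefs s l]
  ++ [seq (f ^ u, g ^ (b1 * gen s)) | u <- prefs s l].
have LP p : p \in L -> conj_sep (fun v => D v && adj s v) p.1 p.2.
  rewrite mem_cat => /orP[] /mapP[u ul ->] /=; apply: IH.
  - by apply: parabJ => //; apply: Fprefs.
  - by apply: parabJ => //; apply: UF.
  - by apply: parabJ => //; apply: Fprefs.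
  - by apply: parabJ => //; apply: parabM => //; apply: UF.
move=> a; have [b0 b0P] := conj_sep_list LP a.
pose th := pair_level a b0.
have [interF _] := cent_inter_all two F.
pose ls1 := if 1 < size l then l else [::].
have ls1P c : c \in ls1 -> sup F c /\ ~ parab (star s) c.
  by rewrite /ls1; case: ifP => // l2 cl; split; [apply/UF/lU | apply: ls].
(* Pulling [th] back along [retr D] allows c, known only to lie in the star, to be replaced by its
   retraction. *)
have [b [bth bsep]] := exists_separated_all interF ls1P (pull_level th D).
exists (pair_level b (magnus_level b s (size l))) => x Dx.
rewrite pair_levelE => -[bfx Mfx].
have [||||||m [k [u [c [ul sc]]]]] := cyc_conjugate _ _ _ _ _ _ bfx Mfx => //.
- by move=> c /lU /US.
- by move=> c /l'U1 /US.
- exact: US.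
- by move=> l2 c cl; apply: bsep; rewrite /ls1 l2.
rewrite -/f -/b1; set Z := _ * _ ^+ k => /bth /= xE0.
have powD i : parab D (f ^+ i).
  by elim: i => [|i IHi]; [rewrite expg0; apply: parab1 | rewrite expgS; apply: parabM].
have DZ : parab D Z by apply: parabM => //; apply: parabV.
have Zf : f * Z = Z * f.
  have cf i : commute f (f ^+ i) by apply: commuteX.
  by apply: commuteM => //; apply: commuteV.
clearbody Z; have Du := Dprefs u ul.
have [c0 Lc0 cE] : exists2 y, parab (fun v => D v && adj s v) y &
    retr D c = y \/ retr D c = y * gen s.
  by apply: star_split; apply: parabI; [apply: retr_parab | apply: parab_retr].
have Db1 := UD _ Ub1.
have [e [De ee ce pL]] : exists e, [/\ parab D e, e * e = 1, retr D c = c0 * e &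
    (f ^ u, g ^ (b1 * e)) \in L].
  case: cE => ->; [exists 1 | exists (gen s)]; split=> //; rewrite ?mulg1 ?gen_sq //.
  - exact: parab1.
  - by rewrite mem_cat; apply/orP; left; apply/mapP; exists u.
  - by rewrite mem_cat; apply/orP; right; apply/mapP; exists u.
have xE : th x = th (Z * u * c0 * e * b1^-1).
  have E : th (x * b1) = th (Z * u * (c0 * e)).
    by move: xE0; rewrite !(homM (retr D)) Dx [retr D b1]Db1 [retr D Z]DZ [retr D u]Du ce.
  by apply: (mulIg (th b1)); rewrite -!(homM th) E mulgVK !mulgA.
have [xa x0] : a x = a (Z * u * c0 * e * b1^-1) /\ b0 x = b0 (Z * u * c0 * e * b1^-1).
  by apply/pair_levelE.
have fL y : f * (Z * u * y * e * b1^-1) = Z * u * (f ^ u * y) * (e * b1^-1).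
  by rewrite conjgE !mulgA Zf mulgK.
have eV : e^-1 = e by apply/mulg1_eq.
have gR y : Z * u * y * e * b1^-1 * g = Z * u * (y * g ^ (b1 * e)) * (e * b1^-1).
  by rewrite conjgE invgM eV -!mulgA [e * (e * _)]mulgA ee mul1g mulgV mulg1.
have fx0 : b0 (f * x) = b0 (x * g).
  have /= := bth _ _ bfx; rewrite [retr D (f * x)]homM [retr D (x * g)]homM Df Dx Dg.
  by case/pair_levelE.
have fc : b0 (f ^ u * c0) = b0 (c0 * g ^ (b1 * e)).
  have : b0 (f * (Z * u * c0 * e * b1^-1)) = b0 (Z * u * c0 * e * b1^-1 * g).
    by rewrite homM -x0 -homM fx0 homM x0 -homM.
  by rewrite fL gR !(homM b0) => /mulIg/mulgI.
have [y [Ly fy ay]] := b0P _ pL _ Lc0 fc.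
exists (Z * u * y * e * b1^-1); split.
- have Dy : parab D y by apply: parab_sub Ly => v /andP[].
  by apply: parabM; [do 3!apply: parabM => // | apply: parabV].
- by rewrite fL fy gR.
by rewrite xa !(homM a) ay.
Qed.

(** A nontrivial f has a vertex [s] that no conjugation within G_U removes, so [s] occurs in its
    cyclic form. If g has more letters [s] than f, the two sides are exchanged before [conj_core] is
    applied. *)
Lemma conj_sep_cyclic (F : seq V) (D : pred V) f g :
  sup F f -> parab D f -> sup F g -> parab D g ->
  (forall s f g, s \in F -> D s -> sup F f -> sup F g ->
     conj_sep (fun v => D v && adj s v) f g) -> conj_sep D f g.
Proof.
pose U : pred V := fun v => (v \in F) && D v.
wlog : f g / f <> 1 => [H|f1].
  have [f1|f1] := pselect (f = 1); last exact: H.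
  have [g1|g1] := pselect (g = 1); last first.
    by move=> Ff Df Fg Dg IH; apply: conj_sep_sym; apply: H.
  move=> _ _ _ _ _ a; exists a => x Dx _.
  by exists x; rewrite f1 g1 mul1g mulg1.
move=> Ff Df Fg Dg IH; have Uf := parabI Ff Df; have Ug := parabI Fg Dg.
have [s [sF sD sf]] : exists s, [/\ s \in F, D s &
    forall h, parab U h -> ~ parab (fun v => U v && (v != s)) (f ^ h)].
  apply: contrapT => no; apply: f1; apply: (@conj_all_trivial _ F U) => // [v /andP[]//|s sF Us].
  apply: contrapT => no2; apply: no; exists s; split=> //; first by case/andP: Us.
  by move=> h Uh fh; apply: no2; exists h.
have Us : U s by rewrite /U sF.
have UD x : parab U x -> parab D x by apply: parab_sub => v /andP[].
have [h [l [z [Uh fh lU [l0|[z1 ls]]]]]] := cyclic_form Us Uf.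
  by case: (sf h Uh); rewrite fh l0 /= mul1g; apply/lU/mem_head.
have lU1 a : a \in l -> parab (fun v => U v && (v != s)) a.
  by move=> al; apply: lU; rewrite inE al orbT.
have l_gt0 : 0 < size l.
  rewrite lt0n size_eq0; apply/eqP => l0; apply: (sf h Uh).
  by rewrite fh l0 /= mul1g; apply/lU/mem_head.
have [k [l' [z' [Uk gk l'U l'E]]]] := cyclic_form Us Ug.
apply: (conj_sep_conj (UD _ Uh) (UD _ Uk)); rewrite fh gk z1 mulg1.
have IHs f' g' := IH s f' g' sF sD.
have [l'l|ll'] := leqP (size l') (size l); first exact: (conj_core sF sD).
case: l'E => [l'0|[z'1 l's]]; first by rewrite l'0 in ll'.
apply: conj_sep_sym; rewrite z'1 mulg1 -[cprod s l]mulg1.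
apply: (conj_core sF sD) => //.
- by move=> c cl; apply: l'U; rewrite inE cl orbT.
- by move=> c; rewrite inE => /predU1P[->|/lU1//]; apply: parab1.
- exact: leq_trans ll'.
exact: ltnW.
Qed.

(** The hypothesis puts f^-1 G_D g inside G_D, so g = f e with e in G_D and f^-1 G_D f lies in G_D.
    Then f = f2 (retr D f) with f2 centralizing G_D, and f2 cancels from the equation. *)
Lemma conj_sep_normal (D : pred V) f g u w :
  (forall k, parab D k -> parab D (u * k * w) /\ parab D (f^-1 * (u * k * w) * g)) ->
  conj_sep D (retr D f) (retr D g) -> conj_sep D f g.
Proof.
move=> uw fg.
have Dfg d : parab D d -> parab D (f^-1 * d * g).
  (* This is the k with u k w = d, because u k w lies in G_D and so equals its retraction. *)
  move=> Dd; have Dk : parab D ((retr D u)^-1 * d * (retr D w)^-1).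
    have rV x : parab D (retr D x)^-1 by apply/parabV/retr_parab.
    by apply: parabM => //; apply: parabM.
  have [E1 E2] := uw _ Dk; have dE : u * ((retr D u)^-1 * d * (retr D w)^-1) * w = d.
    by rewrite -[LHS]E1 !homM !homV !(retr_parab D) Dd !mulgA mulgV mul1g mulgVK.
  by rewrite dE in E2.
pose e := f^-1 * g; have De : parab D e.
  by have := Dfg 1 (parab1 _); rewrite mulg1.
have gE : g = f * e by rewrite /e mulVKg.
clearbody e.
pose f2 := f * (retr D f)^-1.
have f2C d : parab D d -> f2 * d = d * f2.
  move=> Dd; have Dfd : parab D (f^-1 * d * f).
    have -> : f^-1 * d * f = (f^-1 * d * g) * e^-1 by rewrite gE !mulgA mulgK.
    by apply: parabM; [apply: Dfg | apply: parabV].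
  have E : f^-1 * d * f = (retr D f)^-1 * d * retr D f.
    by rewrite -[LHS]Dfd !homM homV Dd.
  have : f * (f^-1 * d * f) * (retr D f)^-1 = d * f2 by rewrite /f2 !mulgA mulgV mul1g.
  by rewrite E => <-; rewrite /f2 !mulgA mulgK.
have fE : f = f2 * retr D f by rewrite /f2 mulgVK.
clearbody f2.
have g1E : retr D g = retr D f * e by rewrite gE homM De.
have fL x : f * x = f2 * (retr D f * x) by rewrite {1}fE mulgA.
have gR x : parab D x -> x * g = f2 * (x * retr D g).
  by move=> Dx; rewrite g1E gE {1}fE !mulgA (f2C _ Dx).
move=> a; have [b bP] := fg a; exists b => x Dx.
rewrite fL gR // !(homM b f2) => /mulgI /(bP _ Dx)[y [Dy fy ay]].
by exists y; split=> //; rewrite fL fy gR.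
Qed.

Lemma count_lt (T : eqType) (P Q : pred T) (l : seq T) x :
  (forall y, Q y -> P y) -> x \in l -> P x -> ~~ Q x -> count Q l < count P l.
Proof.
move=> QP xl Px Qx; elim: l xl => //= y l IH; rewrite inE => /predU1P[<-|/IH].
  by rewrite Px (negbTE Qx) add0n add1n ltnS sub_count.
by rewrite -addnS; apply: leq_add; case Qy: (Q y) => //; rewrite QP.
Qed.

Definition dominates (t : V) (D : pred V) : bool := `[< forall v, D v -> adj t v >].

(** Induction on the number [mu D] of vertices of [F] not adjacent to all of [D]. Solutions lie in
    G_D and in f G_D g^-1, hence in a translate u G_K w: either [mu K] is smaller and x = u k w is
    substituted, or K = D and [conj_sep_normal] applies. *)
Lemma conj_sepP (F : seq V) (D : pred V) f g : sup F f -> sup F g -> conj_sep D f g.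
Proof.
pose mu (D : pred V) := count (fun t => ~~ dominates t D) F.
have [n] := ubnP (mu D); elim: n D f g => // n IH D f g Dn Ff Fg.
have mu_dec (D' : pred V) t : (forall v, D' v -> D v) -> t \in F ->
    dominates t D' -> ~~ dominates t D -> mu D' < n.
  move=> D'D tF tD' tD; rewrite -ltnS; apply: leq_trans Dn; rewrite ltnS.
  apply: count_lt tF _ _ => //; last by rewrite negbK.
  by move=> y; apply: contra => /asboolP yD; apply/asboolP => v /D'D /yD.
have [interF _] := cent_inter_all two F.
case: (interF D D f g Ff Fg) => [[b bN]|[u [w [T [Fu Fw TF TE Ta]]]]].
  move=> a; exists b => x Dx fx; case: (bN x).
  by split=> //; exists x.
set K : pred V := fun v => D v && D v && links T v in TE Ta.
have KD v : K v -> D v by case/andP => /andP[].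
have [/hasP[t tT tD]|/hasPn TD] := boolP (has (fun t => ~~ dominates t D) T); last first.
  have DK v : D v -> K v.
    move=> Dv; rewrite /K Dv /=; apply/allP => t /TD; rewrite negbK => /asboolP.
    exact.
  apply: (@conj_sep_normal D f g u w) => [k Dk|].
    have /TE[E1 E2] := parab_sub DK Dk; split=> //; by rewrite !mulgA in E2 *.
  apply: (@conj_sep_cyclic F); try exact: parab_retr; try exact: retr_parab.
  (* [s] is adjacent to its whole link but not to itself, a vertex of [D], so [mu] drops. *)
  move=> s f1 g1 sF Ds Ff1 Fg1; apply: IH => //; apply: (mu_dec _ s) => //.
  - by move=> v /andP[].
  - by apply/asboolP => v /andP[].
  by apply/asboolP => /(_ s Ds); rewrite adj_irr.
have muK : mu K < n.
  apply: (mu_dec _ t) => //; first exact: TF.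
  by apply/asboolP => v /andP[_ /allP/(_ t tT)].
have FJ x y : sup F x -> sup F y -> sup F (x ^ y) by apply: parabJ.
have := IH K (f ^ u) (g ^ w^-1) muK (FJ _ _ Ff Fu) (FJ _ _ Fg (parabV Fw)).
move=> fgK a; have [b1 b1P] := fgK a; have [b2 b2N] := Ta (pair_level b1 a).
exists (pair_level b1 b2) => x Dx; rewrite pair_levelE => -[fx1 fx2].
have [|k Kk /pair_levelE[xk1 xka]] := b2N x; first by split=> //; exists x.
have fL y : f * (u * y * w) = u * (f ^ u * y) * w by rewrite conjgE !mulgA mulgV mul1g.
have gR y : u * y * w * g = u * (y * g ^ w^-1) * w.
  by rewrite conjVE !mulgA mulgVK.
have [|y [Ky fy ay]] := b1P k Kk.
  have : b1 (f * (u * k * w)) = b1 (u * k * w * g).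
    by rewrite homM -xk1 -homM fx1 homM xk1 -homM.
  by rewrite fL gR !(homM b1) => /mulIg/mulgI.
exists (u * y * w); split.
- by have [] := TE y Ky.
- by rewrite fL fy gR.
by rewrite xka !(homM a) ay.
Qed.
End Conjugacy.

(** * Passage to open subgroups *)

Section Main.
Variables (Gamma : simplicial_graph) (two : bool).
Local Notation G := (right_angled_coxeter_group Gamma).

Definition class_of : finGroupType -> Prop :=
  if two then finite_pgroups 2 else finite_groups.

Lemma conj_separation (f g : G) (a : level Gamma two) :
  exists b : level Gamma two, forall x, b (f * x) = b (x * g) ->
  exists y, f * y = y * g /\ a y = a x.
Proof.
have [F1 F1f] := finite_support f; have [F2 F2g] := finite_support g.
have [|| b bP] := @conj_sepP Gamma two (F1 ++ F2) predT f g _ _ a.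
- by apply: parab_sub F1f => v; rewrite mem_cat => ->.
- by apply: parab_sub F2g => v; rewrite mem_cat => ->; rewrite orbT.
by exists b => x /(bP x (retrT x))[y [_ fy ay]]; exists y.
Qed.

Lemma class_ofP (F : finGroupType) : class_of F <-> (two -> 2.-group [set: F]).
Proof. by rewrite /class_of; case: two; split=> // H; apply: H. Qed.

(** The exact conjugator in G agrees modulo [a] with an element of [H], hence lies in [H] itself. *)
Lemma conjugacy_separable_via (H : groupType) (i : {multiplicative H -> G})
    (a : level Gamma two) :
  injective i -> (forall h y, a y = a (i h) -> exists h', i h' = y) ->
  conjugacy_separable class_of H.
Proof.
move=> i_inj ia f g fg; have [b bP] := conj_separation (i f) (i g) a.
(* The finite group is only the image of [H], so that every conjugating element in it comes from
   [H]. *)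
exists (subg_of (hom_image_group (b \o i))); split.
  apply/class_ofP => t; have := lclass b t; rewrite /pgroup !cardsT.
  apply: pnat_dvd; rewrite -[#|lgrp b|]cardsT.
  apply: (dvdn_trans _ (cardSg (finset.subsetT (hom_image_group (b \o i))))).
  by rewrite card_sub; apply: dvdnn.
exists (corestriction (b \o i)) => -[y]; have [x <-] := corestriction_surj y.
rewrite conjgE => /(congr1 sgval); rewrite !sgval_corestriction /= => gE.
apply: fg; case: (bP (i x)) => [|z [fz za]].
  by rewrite [LHS](homM b) [RHS](homM b) gE !sgval_corestriction mulVKg.
have [h hz] := ia _ _ za; exists h; apply: i_inj.
by rewrite conjgE !homM homV hz fz mulKg.
Qed.

Lemma class_open_level (H : groupClosed G) : class_open class_of H ->
  exists a : level Gamma two, forall x y, y \in H -> a x = a y -> x \in H.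
Proof.
case=> K [KH [F [CF [phi phi_bij]]]].
pose pi (x : G) : quotient_group K := (\pi_(quotient_group K) x)%qT.
have piM : {morph pi : x y / x * y}.
  by move=> x y; rewrite /pi -pi_quotient_mul.
pose piX := HB.pack_for {multiplicative G -> quotient_group K} pi
  (isMultiplicative.Build _ _ pi piM).
exists (@Level Gamma two F (phi \o piX) (proj1 (class_ofP F) CF)) => x y yH /=.
move=> /(bij_inj phi_bij)/quotient_eqP/KH.
by rewrite -gpredV invgM invgK => xyH; rewrite -(mulVKg y x) gpredM.
Qed.
End Main.

Lemma racg_hereditary Gamma two : hereditarily_conjugacy_separable (class_of two)
  (right_angled_coxeter_group Gamma).
Proof.
split.
  pose i : {multiplicative right_angled_coxeter_group Gamma -> _} := idfun.
  apply: (@conjugacy_separable_via Gamma two _ i (trivial_level Gamma two)) => // h y _.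
  by exists y.
move=> H /class_open_level[a aH].
pose i : {multiplicative subgroup_type H -> right_angled_coxeter_group Gamma} := val.
apply: (@conjugacy_separable_via Gamma two _ i a); first exact: val_inj.
move=> h y /aH yH; have {}yH := yH (valP h).
by exists (exist _ y yH).
Qed.

Theorem corollary7p6 (Gamma : simplicial_graph) :
  hereditarily_conjugacy_separable finite_groups
    (right_angled_coxeter_group Gamma) /\
  hereditarily_conjugacy_separable (finite_pgroups 2)
    (right_angled_coxeter_group Gamma).
Proof.
split; [exact: (racg_hereditary Gamma false) | exact: (racg_hereditary Gamma true)].
Qed.
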